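(* Let $n\ge 2$ and let $0\ne A\in sp(\mathbb{R}^{2n+2},\Omega')$ satisfy $A^2=\lambda I$ for a constant $\lambda\in\mathbb{R}$, with $\Sigma_A=\{x\in\mathbb{R}^{2n+2}:\Omega'(x,Ax)=1\}$ non-empty. Then the quotient $M$ of $\Sigma_A$ by the action of $\exp tA$ ($t\in\mathbb{R}$) is a manifold and the natural projection map $\Sigma_A\to M$ is a submersion which endows $\Sigma_A$ with a structure of circle or line bundle over $M$.
   Context: $\Omega'$ is the standard symplectic structure on $\mathbb{R}^{2n+2}$ and $sp(\mathbb{R}^{2n+2},\Omega')$ its symplectic Lie algebra; the one-parameter group $\exp tA$ preserves the hypersurface $\Sigma_A$. Manifolds are not required to be connected. *)

(* Defs.v *)
From HB Require Import structures.
From mathcomp Require Import all_boot all_order all_algebra generic_quotient.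
From mathcomp Require Import all_classical all_reals all_analysis.

Set Implicit Arguments.
Unset Strict Implicit.
Unset Printing Implicit Defensive.

Import Order.TTheory GRing.Theory Num.Theory.
Import numFieldNormedType.Exports.

Local Open Scope classical_set_scope.
Local Open Scope ring_scope.

Section Smooth.
Context {R : realType}.

(* [Ck k U f] is meant for open [U]; in finite dimension, C^(k+1) amounts to
   differentiability together with all directional derivatives being C^k. *)
Fixpoint Ck (k : nat) {p q : nat} (U : set 'cV[R]_p) (f : 'cV[R]_p -> 'cV[R]_q)
    {struct k} : Prop :=
  if k is k'.+1 then
    (forall x, U x -> differentiable f x) /\
    (forall v, Ck k' U (fun x => 'D_v f x))
  else forall x, U x -> {for x, continuous f}.

Definition smooth_on {p q : nat} (U : set 'cV[R]_p) (f : 'cV[R]_p -> 'cV[R]_q) :=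
  forall k, Ck k U f.

(* Both maps of a chart are total; only [chart_map] on [chart_dom] and
   [chart_inv] on [chart_img] are meaningful. *)
Record chart (T : Type) (d : nat) := Chart {
  chart_dom : set T;
  chart_map : T -> 'cV[R]_d;
  chart_inv : 'cV[R]_d -> T }.

Definition chart_img T d (c : chart T d) : set 'cV[R]_d :=
  chart_map c @` chart_dom c.

Definition is_chart (T : topologicalType) d (c : chart T d) : Prop :=
  [/\ open (chart_dom c),
      open (chart_img c),
      forall x, chart_dom c x -> chart_inv c (chart_map c x) = x,
      forall x, chart_dom c x -> {for x, continuous (chart_map c)} &
      forall z, chart_img c z -> {for z, continuous (chart_inv c)}].

Definition smooth_atlas (T : topologicalType) d (a : set (chart T d)) : Prop :=
  [/\ forall c, a c -> is_chart c,
      forall x, exists2 c, a c & chart_dom c x &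
      forall c c', a c -> a c' ->
        smooth_on (chart_map c @` (chart_dom c `&` chart_dom c'))
                  (chart_map c' \o chart_inv c)].

Definition is_manifold (T : topologicalType) d (a : set (chart T d)) : Prop :=
  [/\ hausdorff_space T, @second_countable T & smooth_atlas a].

Definition in_charts (E B : Type) d e (f : E -> B) (c : chart E d)
    (c' : chart B e) : 'cV[R]_d -> 'cV[R]_e :=
  chart_map c' \o f \o chart_inv c.

Definition smooth_map_on (E B : topologicalType) d e (aE : set (chart E d))
    (aB : set (chart B e)) (W : set E) (f : E -> B) : Prop :=
  (forall x, W x -> {for x, continuous f}) /\
  (forall c c', aE c -> aB c' ->
     smooth_on (chart_map c @` (W `&` chart_dom c `&` f @^-1` chart_dom c'))
               (in_charts f c c')).

Definition submersion (E B : topologicalType) d e (aE : set (chart E d))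
    (aB : set (chart B e)) (f : E -> B) : Prop :=
  smooth_map_on aE aB setT f /\
  (forall c c' x, aE c -> aB c' -> chart_dom c x -> chart_dom c' (f x) ->
     forall w, exists v, 'd (in_charts f c c') (chart_map c x) v = w).

Definition euclidean_atlas d : set (chart 'cV[R]_d d) :=
  [set @Chart 'cV[R]_d d setT id id].

Definition prod_chart (T1 T2 : Type) d1 d2 (c1 : chart T1 d1) (c2 : chart T2 d2)
    : chart (T1 * T2)%type (d1 + d2) :=
  Chart (chart_dom c1 `*` chart_dom c2)
        (fun x => col_mx (chart_map c1 x.1) (chart_map c2 x.2))
        (fun z => (chart_inv c1 (usubmx z), chart_inv c2 (dsubmx z))).

Definition prod_atlas (T1 T2 : Type) d1 d2 (a1 : set (chart T1 d1))
    (a2 : set (chart T2 d2)) : set (chart (T1 * T2)%type (d1 + d2)) :=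
  [set c | exists c1 c2, [/\ a1 c1, a2 c2 & c = prod_chart c1 c2]].

(* The smooth structure that a subset [S] of R^N inherits: its charts are all
   the homeomorphisms from an open subset of [S] to an open subset of R^d that
   are diffeomorphisms for the ambient notion of smoothness, where a map on a
   subset of R^N is smooth when it extends smoothly near each point.  [S] is an
   embedded d-dimensional submanifold iff this is a smooth atlas. *)
Definition sub_atlas N d (S : set 'cV[R]_N) : set (chart (set_type S) d) :=
  [set c | [/\ is_chart c,
      smooth_on (chart_img c) (fun z => set_val (chart_inv c z)) &
      forall x, chart_dom c x ->
        exists (W : set 'cV[R]_N) (F : 'cV[R]_N -> 'cV[R]_d),
          [/\ open W, W (set_val x), smooth_on W F &
              forall y, chart_dom c y -> W (set_val y) ->
                chart_map c y = F (set_val y)]]].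

End Smooth.
Arguments sub_atlas {R N} d S.

Section Bundle.
Context {R : realType}.

(* A local trivialisation of pi : E -> B with fibre F over [triv_base], with
   x |-> (pi x, triv_fib x) and its inverse triv_inv. *)
Record triv (E B F : Type) := Triv {
  triv_base : set B;
  triv_fib : E -> F;
  triv_inv : B * F -> E }.

Definition is_triv (E B F : topologicalType) dE dB dF
    (aE : set (@chart R E dE)) (aB : set (@chart R B dB))
    (aF : set (@chart R F dF)) (pi : E -> B) (t : triv E B F) : Prop :=
  [/\ open (triv_base t),
      smooth_map_on aE aF (pi @^-1` triv_base t) (triv_fib t),
      smooth_map_on (prod_atlas aB aF) aE (triv_base t `*` setT) (triv_inv t),
      forall b y, triv_base t b ->
        pi (triv_inv t (b, y)) = b /\ triv_fib t (triv_inv t (b, y)) = y &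
      forall x, triv_base t (pi x) -> triv_inv t (pi x, triv_fib t x) = x].

(* [G] is the structure group, as a set of transformations of the fibre. *)
Definition fibre_bundle (E B F : topologicalType) dE dB dF
    (aE : set (@chart R E dE)) (aB : set (@chart R B dB))
    (aF : set (@chart R F dF)) (G : set (F -> F)) (pi : E -> B) : Prop :=
  smooth_map_on aE aB setT pi /\
  exists ts : set (triv E B F),
    [/\ forall t, ts t -> is_triv aE aB aF pi t,
        forall b, exists2 t, ts t & triv_base t b &
        forall t t' b, ts t -> ts t' -> triv_base t b -> triv_base t' b ->
          G (fun y => triv_fib t' (triv_inv t (b, y)))].

Definition circle : set 'cV[R]_2 := [set z | z 0 0 ^+ 2 + z 1 0 ^+ 2 = 1].

Definition rotations : set (set_type circle -> set_type circle) :=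
  [set g | exists Q : 'M[R]_2, [/\ Q^T *m Q = 1%:M, \det Q = 1 &
     forall z, set_val (g z) = Q *m set_val z]].

Definition circle_bundle (E B : topologicalType) dE dB
    (aE : set (@chart R E dE)) (aB : set (@chart R B dB)) (pi : E -> B) : Prop :=
  fibre_bundle aE aB (sub_atlas 1 circle) rotations pi.

Definition scalings : set ('cV[R]_1 -> 'cV[R]_1) :=
  [set g | exists2 a : R, a != 0 & forall y, g y = a *: y].

Definition line_bundle (E B : topologicalType) dE dB
    (aE : set (@chart R E dE)) (aB : set (@chart R B dB)) (pi : E -> B) : Prop :=
  fibre_bundle aE aB (@euclidean_atlas R 1) scalings pi.

End Bundle.

Section Symplectic.
Local Open Scope quotient_scope.
Context {R : realType}.

Definition Omega (m : nat) (x y : 'cV[R]_(m + m)) : R :=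
  (x^T *m block_mx 0 1%:M (- 1%:M) 0 *m y) 0 0.

Definition sp (m : nat) : set 'M[R]_(m + m) :=
  [set A | forall x y, Omega (A *m x) y + Omega x (A *m y) = 0].

Definition expmx (N : nat) (A : 'M[R]_N) : 'M[R]_N :=
  limn (series (fun k => k`!%:R^-1 *: A ^+ k)).

Variables (m : nat) (A : 'M[R]_(m + m)).

Definition Sigma : set 'cV[R]_(m + m) := [set x | Omega x (A *m x) = 1].

Definition orbit (x : set_type Sigma) : set (set_type Sigma) :=
  [set y | exists t : R, set_val y = expmx (t *: A) *m set_val x].

Definition same_orbit (x y : set_type Sigma) : bool := `[< orbit x = orbit y >].

Lemma same_orbit_refl : reflexive same_orbit.
Proof. by move=> x; apply/asboolP. Qed.

Lemma same_orbit_sym : symmetric same_orbit.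
Proof. by move=> x y; apply/asboolP/asboolP => ->. Qed.

Lemma same_orbit_trans : transitive same_orbit.
Proof. by move=> y x z /asboolP xy /asboolP yz; apply/asboolP; rewrite xy. Qed.

Canonical same_orbit_equiv :=
  EquivRel same_orbit same_orbit_refl same_orbit_sym same_orbit_trans.

Definition orbit_space := quotient_topology {eq_quot same_orbit_equiv}.
HB.instance Definition _ := Topological.on orbit_space.
HB.instance Definition _ := Quotient.on orbit_space.

Definition orbit_proj : set_type Sigma -> orbit_space := \pi_orbit_space.

End Symplectic.
Arguments sp {R m}.
Arguments Sigma {R m} A.
Arguments orbit_space {R m} A.
Arguments orbit_proj {R m} A x.

(* Main.v *)
Require Import Defs.
From HB Require Import structures.
From mathcomp Require Import all_boot all_order all_algebra generic_quotient.
From mathcomp Require Import all_classical all_reals all_analysis.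
From mathcomp Require Import zify ring lra.

(** Since A^2 = lambda, the space V = R^(2n+2) is a module over the commutative
    algebra C = R[e]/(e^2 - lambda), where e acts as A.  Write z = a + b e,
    conj z = a - b e and N(z) = z conj z = a^2 - lambda b^2.  The form
    q(x) = Omega(x, A x) satisfies q(z x) = N(z) q(x), because A lies in the
    symplectic Lie algebra, and the matrices exp(tA) are exactly the units of
    norm 1 in the identity component ([expmx_zunit], [zunit_expmx]): cosines and
    sines, 1 + tA, or hyperbolic functions, according to the sign of lambda.
    Call this group G; it is a circle if lambda < 0 and a line otherwise.  The
    hypersurface Sigma_A is the quadric q = 1, and everything below is algebra
    over C combined with square roots of positive functions.

    The hypersurface.  A quadric q = 1 is charted by central projection: where
    a linear form h is positive, x |-> x / h(x) lands in the affine hyperplane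
    h = 1, and y |-> y / sqrt(q(y)) goes back ([quadric_covers]).  The circle is
    another instance.

    The quotient.  Fix u on Sigma_A.  The C-valued form
    h_u(x) = Omega(x, A u) + Omega(u, x) e is C-linear in x and h_u(u) = 1, so
    V = C u + W with W the kernel of h_u, which has dimension 2n.  Where h_u(x)
    lies in the open cone D = R_(>0) G, the point h_u(x)^-1 x depends only on the
    orbit of x and lies in the affine space u + W.  This is the projective
    chart of the quotient, with image the set where q > 0 and inverse
    y |-> [y / sqrt(q(y))] ([slice_chart_img], [is_chart_slice]).  The inverse
    lifts to Sigma_A, and translating the lift by G gives smooth sections of the
    projection through every point, so the projection is a submersion.  The
    quotient is Hausdorff because x and y lie in one orbit iff y = h_x(y) x with
    h_x(y) in G, which is a closed condition ([hausdorff_orbit_space]).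

    The bundle.  A smooth map T from an invariant open set to G with
    T(g x) = g T(x) trivialises the projection by x |-> ([x], T(x)), the inverse
    being ([x], g) |-> g T(x)^-1 x ([equivariant_trivP]).  If lambda < 0, the maps
    h_u / sqrt(N(h_u)) do this locally; two of them differ by a factor in G that
    is constant on orbits, that is, by a rotation.  If lambda >= 0, translations
    of the line are not linear, so a single global T is used:
    K(x) = (lambda |x|^2 + |A x|^2) / 2 + (x . A x) e satisfies K(g x) = g^2 K(x)
    and lies in D on Sigma_A, and T is the square root in G of K / sqrt(N(K))
    ([line_coord_equivariant]). *)

Set Implicit Arguments.
Unset Strict Implicit.
Unset Printing Implicit Defensive.

Import Order.TTheory GRing.Theory Num.Theory.
Import numFieldNormedType.Exports.

Local Open Scope classical_set_scope.
Local Open Scope ring_scope.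

(** * Calculus of C^k maps *)

Section Calculus.
Context {R : realType}.

(** [Ck] with an arbitrary normed module as codomain, so that scalar functions
    can be handled directly and vector-valued ones coordinate by coordinate. *)
Fixpoint Cn (k : nat) {p : nat} {W : normedModType R} (U : set 'cV[R]_p)
    (f : 'cV[R]_p -> W) {struct k} : Prop :=
  if k is k'.+1 then
    (forall x, U x -> differentiable f x) /\
    (forall v, Cn k' U (fun x => 'D_v f x))
  else forall x, U x -> {for x, continuous f}.

Lemma CkE k p q (U : set 'cV[R]_p) (f : 'cV[R]_p -> 'cV[R]_q) :
  Ck k U f <-> Cn k U f.
Proof.
elim: k f => [|k IH] f //=; split=> -[df Df]; split=> // v; exact/IH.
Qed.

(** Total functions that agree only near a point have the same first-order
    expansion there; this is what makes [Cn] a local notion. *)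
Lemma near_eq_differentiable (V W : normedModType R) (f g : V -> W) (x : V) :
  (\near x, f x = g x) -> differentiable f x -> differentiable g x.
Proof.
move=> fg /diff_locallyP[cd E].
have Eg : g \o shift x = cst (g x) + 'd f x +o_ (0 : V) id.
  apply/eqaddoP => e e0; move/eqaddoP: (E) => /(_ e e0) He.
  have {}fg : \forall h \near (0 : V), f (h + x) = g (h + x).
    by move: fg; rewrite (near_shift 0 x); apply: filterS => h /=; rewrite subr0.
  have fgx : f x = g x by move: (nbhs_singleton fg); rewrite add0r.
  near=> h; have : f (h + x) = g (h + x) by near: h.
  rewrite -fgx => fgh; rewrite [leLHS](_ : _ =
    `|(f \o shift x - (cst (f x) + 'd f x)) h|); first by near: h.
  by rewrite !fctE /= fgh.
apply/diff_locallyP; rewrite (diff_unique cd Eg); split=> //.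
Unshelve. all: by end_near.
Qed.

Section Fixed.
Context {p : nat} {W : normedModType R}.
Implicit Types (U : set 'cV[R]_p) (f g : 'cV[R]_p -> W).

Lemma Cn_sub k U U' f : U' `<=` U -> Cn k U f -> Cn k U' f.
Proof.
move=> sUU'; elim: k f => [|k IH] f /=; first by move=> + x /sUU'; exact.
by move=> [df Df]; split=> [x /sUU' /df//|v]; exact: IH.
Qed.

(** Openness matters: the derivatives in [Cn] see a neighbourhood of each
    point, so agreement on an arbitrary set would not be enough. *)
Lemma Cn_eq k U f g : open U -> (forall x, U x -> f x = g x) ->
  Cn k U f -> Cn k U g.
Proof.
move=> oU; elim: k f g => [|k IH] f g fg /=.
  move=> cf x Ux; have fgx : \forall y \near x, f y = g y.
    by near=> y; apply/fg; near: y; exact: open_nbhs_nbhs.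
  rewrite /prop_for /continuous_at -(fg x)//.
  exact: cvg_trans (near_eq_cvg fgx) (cf x Ux).
have near_fg x : U x -> \forall y \near x, f y = g y.
  by move=> Ux; near=> y; apply/fg; near: y; exact: open_nbhs_nbhs.
move=> [df Df]; split=> [x Ux|v].
  exact: near_eq_differentiable (near_fg _ Ux) (df _ Ux).
apply: IH (Df v) => x Ux; exact/near_eq_derive/near_fg.
Unshelve. all: by end_near.
Qed.

Lemma Cn_pred k U f : Cn k.+1 U f -> Cn k U f.
Proof.
elim: k f => [|k IH] f; first by move=> /= -[df _] x /df/differentiable_continuous.
by move=> [df Df]; split=> // v; exact: IH.
Qed.

Lemma Cn_cst k U (w : W) : Cn k U (cst w).
Proof.
elim: k w => [|k IH] w /=; first by move=> x _; exact: cst_continuous.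
split=> [x _|v]; first exact: differentiable_cst.
by rewrite (_ : (fun x => _) = cst 0)//; apply/funext => x; rewrite derive_cst.
Qed.

Lemma CnD k U f g : open U -> Cn k U f -> Cn k U g -> Cn k U (fun x => f x + g x).
Proof.
move=> oU; elim: k f g => [|k IH] f g /=.
  by move=> cf cg x Ux; exact: (cvgD (cf x Ux) (cg x Ux)).
move=> [df Df] [dg Dg]; split=> [x Ux|v].
  by apply: differentiableD; [exact: df|exact: dg].
apply: Cn_eq oU _ (IH _ _ (Df v) (Dg v)) => x Ux.
by rewrite -deriveD//; apply: diff_derivable; [exact: df|exact: dg].
Qed.

Lemma Cn_sum (I : Type) (r : seq I) (P : pred I) k U (F : I -> 'cV[R]_p -> W) :
  open U -> (forall i, Cn k U (F i)) -> Cn k U (fun x => \sum_(i <- r | P i) F i x).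
Proof.
move=> oU cF; elim: r => [|i r IH].
  by under eq_fun do rewrite big_nil; exact: Cn_cst.
under eq_fun do rewrite big_cons; case: (P i) => //; exact: CnD.
Qed.

Lemma Cn_scalel k U (a : 'cV[R]_p -> R) (w : W) : open U ->
  Cn k U a -> Cn k U (fun x => a x *: w).
Proof.
move=> oU; elim: k a => [|k IH] a /=.
  by move=> ca x Ux; exact: (cvgZr_tmp (ca x Ux)).
move=> [da Da]; split=> [x Ux|v].
  by apply: differentiableZl; exact: da.
apply: Cn_eq oU _ (IH _ (Da v)) => x Ux.
have da_x := da _ Ux; rewrite !deriveE ?diffZl//.
exact: differentiableZl.
Qed.

End Fixed.

Section Scalar.
Context {p : nat}.
Implicit Types (U : set 'cV[R]_p) (f g : 'cV[R]_p -> R).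

Lemma CnM k U f g : open U -> Cn k U f -> Cn k U g -> Cn k U (fun x => f x * g x).
Proof.
move=> oU; elim: k f g => [|k IH] f g.
  by move=> cf cg x Ux; exact: (cvgM (cf x Ux) (cg x Ux)).
move=> cf cg; have [df Df] := cf; have [dg Dg] := cg; split=> [x Ux|v].
  by apply: differentiableM; [exact: df|exact: dg].
have := CnD oU (IH _ _ (Cn_pred cf) (Dg v)) (IH _ _ (Cn_pred cg) (Df v)).
apply: Cn_eq => // x Ux.
by rewrite -deriveM//; apply: diff_derivable; [exact: df|exact: dg].
Qed.

(** The derivative of f^(-1/2) is -1/2 (f^(-1/2))^3 f', which again contains
    only f^(-1/2) and a derivative of f, so the induction closes. *)
Lemma Cn_inv_sqrt k U f : open U -> (forall x, U x -> 0 < f x) ->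
  Cn k U f -> Cn k U (fun x => (Num.sqrt (f x))^-1 : R).
Proof.
move=> oU fpos; elim: k => [|k IH] cf.
  move=> x Ux; have sx0 : Num.sqrt (f x) != 0.
    by rewrite gt_eqF ?sqrtr_gt0 ?fpos.
  have cs : {for x, continuous (fun x => Num.sqrt (f x))}.
    apply: continuous_comp; first exact: cf.
    exact: sqrt_continuous.
  exact: cvgV sx0 cs.
have r := IH (Cn_pred cf); have [df Df] := cf.
have drv x (Ux : U x) : is_diff (f x) (fun y : R => (Num.sqrt y)^-1 : R)
   (fun h : R => h * (- 2^-1 * (Num.sqrt (f x))^-1 ^+ 3)).
  have fx0 := fpos _ Ux; have sx0 : Num.sqrt (f x) != 0.
    by rewrite gt_eqF ?sqrtr_gt0.
  have [ds Ds] := is_derive1_sqrt fx0.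
  have dsq : differentiable (@Num.sqrt R) (f x) by exact/derivable1_diffP.
  apply: DiffDef; first exact: differentiableV.
  rewrite diffV// deriv1E// derive1E Ds; apply/funext => h /=.
  by rewrite /= scalerA /GRing.scale /=; field.
have dr x (Ux : U x) : differentiable (fun x => (Num.sqrt (f x))^-1 : R) x.
  by have [ds _] := drv x Ux; exact: (differentiable_comp (df x Ux) ds).
split=> [x Ux|v]; first exact: dr.
have r2 := CnM oU r (CnM oU r (CnM oU r (Df v))).
apply: (Cn_eq oU _ (CnM oU (Cn_cst k U (- 2^-1 : R)) r2)) => x Ux.
rewrite [RHS]deriveE; last exact: dr.
have [ds Ed] := drv x Ux.
rewrite (diff_comp (df x Ux) ds) /= Ed /=.
by rewrite deriveE; [rewrite exprS expr2; ring|exact: df].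
Qed.

(** The inverse of f is f times the square of (f^2)^(-1/2). *)
Lemma Cn_inv k U f : open U -> (forall x, U x -> f x != 0) ->
  Cn k U f -> Cn k U (fun x => (f x)^-1).
Proof.
move=> oU f0 cf.
have cf2 := CnM oU cf cf.
have f2 x : U x -> 0 < f x * f x.
  by move=> Ux; rewrite -expr2 exprn_even_gt0 ?f0.
have r := Cn_inv_sqrt oU f2 cf2.
apply: Cn_eq oU _ (CnM oU cf (CnM oU r r)) => x Ux.
by rewrite -invfM -expr2 sqr_sqrtr ?ltW ?f2// invfM mulVKf ?f0.
Qed.

End Scalar.

Section Vector.
Context {p q : nat}.
Implicit Types (U : set 'cV[R]_p).

Lemma Cn_coord k U (f : 'cV[R]_p -> 'cV[R]_q) i :
  open U -> Cn k U f -> Cn k U (fun x => f x i 0).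
Proof.
move=> oU; elim: k f => [|k IH] f /=.
  move=> cf x Ux.
  exact: (continuous_comp (cf x Ux) (@coord_continuous R q 1 i 0 (f x))).
move=> [df Df]; split=> [x Ux|v].
  exact: (differentiable_comp (df x Ux) (@differentiable_coord R q 1 (f x) i 0)).
apply: (Cn_eq oU _ (IH _ (Df v))) => x Ux.
by rewrite derive_mx ?mxE//; exact/diff_derivable/df.
Qed.

Lemma Cn_vec k U (f : 'cV[R]_p -> 'cV[R]_q) : open U ->
  (forall i, Cn k U (fun x => f x i 0)) -> Cn k U f.
Proof.
move=> oU cf; have := Cn_sum (index_enum 'I_q) xpredT oU
  (fun i => Cn_scalel (delta_mx i 0 : 'cV[R]_q) oU (cf i)).
apply: Cn_eq => // x Ux; apply/colP => i; rewrite summxE (bigD1 i)//= big1.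
  by rewrite !mxE !eqxx mulr1 addr0.
by move=> j ji; rewrite !mxE eq_sym (negbTE ji) mulr0.
Qed.

End Vector.

Lemma Cn_id k p (U : set 'cV[R]_p) : Cn k U id.
Proof.
case: k => [|k]; first by move=> x _; exact: cvg_id.
split=> [x _//|v].
by rewrite (_ : (fun x => _) = cst v); [exact: Cn_cst|apply/funext => x; rewrite derive_id].
Qed.

Section Comp.
Context {p q : nat} (U : set 'cV[R]_p) (V : set 'cV[R]_q).
Context (f : 'cV[R]_p -> 'cV[R]_q) (oU : open U) (oV : open V) (fUV : forall x, U x -> V (f x)).

(** The directional derivative of g o f is the sum over i of (D_v f)_i times
    (D_i g) o f, to which the induction hypothesis and the product rule apply. *)
Lemma Cn_comp_scalar k (g : 'cV[R]_q -> R) :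
  Cn k U f -> Cn k V g -> Cn k U (fun x => g (f x)).
Proof.
elim: k g => [|k IH] g.
  by move=> cf cg x Ux; exact: (continuous_comp (cf x Ux) (cg _ (fUV Ux))).
move=> cf cg; have [df Df] := cf; have [dg Dg] := cg.
have dgf x (Ux : U x) : differentiable (fun x => g (f x)) x.
  exact: (differentiable_comp (df x Ux) (dg _ (fUV Ux))).
split=> // v.
have := Cn_sum (index_enum 'I_q) xpredT oU (fun i =>
  CnM oU (Cn_coord i oU (Df v)) (IH _ (Cn_pred cf) (Dg (delta_mx i 0)))).
apply: Cn_eq => // x Ux.
rewrite [RHS]deriveE; last exact: dgf.
rewrite (diff_comp (df x Ux) (dg _ (fUV Ux))) /= -(deriveE _ (df x Ux)).
rewrite [in RHS](matrix_sum_delta ('D_v f x)) linear_sum; apply: eq_bigr => i _.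
rewrite big_ord1 linearZ; congr (_ * _).
by rewrite deriveE//; apply/dg/fUV.
Qed.

Lemma Cn_comp k r (g : 'cV[R]_q -> 'cV[R]_r) :
  Cn k U f -> Cn k V g -> Cn k U (fun x => g (f x)).
Proof.
move=> cf cg; apply: Cn_vec => // i.
exact: (Cn_comp_scalar cf (Cn_coord i oV cg)).
Qed.

End Comp.

Lemma Cn_mulmx k p q r (M : 'M[R]_(r, q)) (U : set 'cV[R]_p)
  (f : 'cV[R]_p -> 'cV[R]_q) : open U ->
  Cn k U f -> Cn k U (fun x => M *m f x).
Proof.
move=> oU cf; apply: Cn_vec => // i.
under eq_fun do rewrite mxE.
by apply: Cn_sum => // j; apply: CnM => //; [exact: Cn_cst|exact: Cn_coord].
Qed.

Lemma CnZ k p q (U : set 'cV[R]_p) (a : 'cV[R]_p -> R) (f : 'cV[R]_p -> 'cV[R]_q) : open U ->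
  Cn k U a -> Cn k U f -> Cn k U (fun x => a x *: f x).
Proof.
move=> oU ca cf; apply: Cn_vec => // i.
under eq_fun do rewrite mxE.
by apply: CnM => //; exact: Cn_coord.
Qed.

End Calculus.

(** * Complements of a split injection *)

Section Complement.

(** The idempotent E = 1 - C D has rank d, and a rank factorisation E = K L
    provides coordinates on the common kernel of the rows of D. *)
Lemma complement_frame (F : fieldType) (N r d : nat) (C : 'M[F]_(N, r))
    (D : 'M[F]_(r, N)) : N = (r + d)%N -> D *m C = 1%:M ->
  exists (K : 'M[F]_(N, d)) (L : 'M[F]_(d, N)),
    [/\ L *m K = 1%:M, K *m L = 1%:M - C *m D, D *m K = 0 & L *m C = 0].
Proof.
move=> Nrd DC1; pose E := 1%:M - C *m D.
have DE0 : D *m E = 0 by rewrite mulmxBr mulmx1 mulmxA DC1 mul1mx subrr.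
have EC0 : E *m C = 0 by rewrite mulmxBl mul1mx -mulmxA DC1 mulmx1 subrr.
have EE : E *m E = E by rewrite {1}/E mulmxBl mul1mx -mulmxA DE0 mulmx0 subr0.
have rD : \rank D = r.
  apply/eqP; rewrite eqn_leq rank_leq_row /= -[X in (X <= _)%N](mxrank1 F r) -DC1.
  exact: mxrankM_maxl.
have rE : \rank E = d.
  apply/eqP; rewrite eqn_leq; apply/andP; split.
    have := mulmx0_rank_max DE0; rewrite rD; move=> H; lia.
  have : (\rank (E + C *m D)%R <= \rank E + r)%N.
    apply: leq_trans (mxrank_add _ _) _; rewrite leq_add2l.
    by apply: leq_trans (mxrankM_maxr _ _) _; rewrite rD.
  rewrite /E subrK mxrank1 => H; lia.
have : exists (K : 'M[F]_(N, d)) (L : 'M[F]_(d, N)),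
  [/\ K *m L = E, row_free L & row_full K].
  rewrite -rE; exists (col_base E), (row_base E).
  by rewrite mulmx_base row_base_free col_base_full.
move=> [K [L [KL fL fK]]]; exists K, L.
have eqL m (X Y : 'M[F]_(m, d)) : X *m L = Y *m L -> X = Y by exact: row_free_inj.
have eqK m (X Y : 'M[F]_(d, m)) : K *m X = K *m Y -> X = Y by exact: row_full_inj.
split=> //.
- apply: eqL; apply: eqK; by rewrite mul1mx -mulmxA KL mulmxA KL EE.
- by apply: eqL; rewrite -mulmxA KL mul0mx.
- by apply: eqK; rewrite mulmxA KL mulmx0.
Qed.

End Complement.

(** * The exponential of a matrix whose square is scalar *)

Section Exponential.
Context {R : realType}.

(** The powers of A alternate between scalars and multiples of A, so the
    exponential series splits into its even and odd parts. *)
Lemma expmx_cvg N (A : 'M[R]_N) (lambda t c s : R) : A *m A = lambda%:M ->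
  series (fun k => (~~ odd k)%:R * (k`!%:R^-1 * t ^+ k * lambda ^+ k./2)) @ \oo --> c ->
  series (fun k => (odd k)%:R * (k`!%:R^-1 * t ^+ k * lambda ^+ k./2)) @ \oo --> s ->
  expmx (t *: A) = c%:M + s *: A.
Proof.
move=> AA cc cs; rewrite /expmx.
apply: (cvg_lim (@norm_hausdorff _ _)).
rewrite [X in X @ _ --> _](_ : _ = (fun n =>
  (series (fun k => (~~ odd k)%:R * (k`!%:R^-1 * t ^+ k * lambda ^+ k./2)) n) *: 1%:M +
  (series (fun k => (odd k)%:R * (k`!%:R^-1 * t ^+ k * lambda ^+ k./2)) n) *: A)).
  rewrite -(scalemx1 _ c).
  by apply: cvgD; apply: cvgZr_tmp.
apply/funext => n; rewrite /series /= !scaler_suml -big_split /=.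
apply: eq_bigr => k _.
have -> : (t *: A) ^+ k = t ^+ k *: A ^+ k.
  elim: k => [|k IH]; first by rewrite !expr0 scale1r.
  by rewrite !exprS IH -!mulmxE -scalemxAl -scalemxAr scalerA.
rewrite scalerA.
have Ak j : A ^+ (j.*2) = (lambda ^+ j)%:M.
  elim: j => [|j IH]; first by rewrite !expr0.
  by rewrite doubleS !exprS IH -!mulmxE mulmxA AA -scalar_mxM.
have -> : A ^+ k = lambda ^+ k./2 *: (if odd k then A else 1%:M).
  rewrite -[k in LHS]odd_double_half; case: (odd k) => /=.
    by rewrite exprS Ak -mulmxE mul_mx_scalar.
  by rewrite Ak scalemx1.
rewrite scalerA; case: (odd k); rewrite ?mul0r ?mul1r ?scale0r ?add0r ?addr0//.
Qed.

Lemma cvg_seriesZ (a l : R) (u v : R ^nat) : (forall k, v k = a * u k) ->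
  series u @ \oo --> l -> series v @ \oo --> a * l.
Proof.
move=> uv ul; rewrite (_ : series v = (fun n => a * series u n)).
  exact: (cvgM (cvg_cst a) ul).
by apply/funext => n; rewrite /series/= mulr_sumr; apply: eq_bigr => k _.
Qed.

Lemma expmx_neg N (A : 'M[R]_N) (kappa t : R) : 0 < kappa ->
  A *m A = (- kappa ^+ 2)%:M ->
  expmx (t *: A) = (cos (kappa * t))%:M + (kappa^-1 * sin (kappa * t)) *: A.
Proof.
move=> k0 AA; have kn0 : kappa != 0 by rewrite gt_eqF.
have E j : (- kappa ^+ 2) ^+ j = (-1) ^+ j * kappa ^+ j.*2.
  by rewrite -[- _]mulN1r exprMn -[in RHS]mul2n exprM.
apply: (expmx_cvg AA).
  rewrite -[cos _]mul1r; apply: (@cvg_seriesZ _ _ (cos_coeff (kappa * t))); last first.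
    by rewrite cos.unlock; exact: is_cvg_series_cos_coeff.
  move=> k; rewrite /cos_coeff /= E -exprnP exprMn mul1r.
  case: (boolP (odd k)) => ok; first by rewrite !mul0r.
  by rewrite [k in _ * kappa ^+ k](_ : _ = k) ?even_halfK//; ring.
apply: (@cvg_seriesZ _ _ (sin_coeff (kappa * t))); last first.
  by rewrite sin.unlock; exact: is_cvg_series_sin_coeff.
move=> k; rewrite /sin_coeff /= E exprMn.
case: (boolP (odd k)) => ok; last by rewrite !mul0r mulr0.
have [-> ->] : k.-1./2 = k./2 /\ kappa ^+ k = kappa * kappa ^+ k./2.*2.
  by rewrite -exprS; split; [lia|congr (_ ^+ _); lia].
by field; rewrite kn0 pnatr_eq0 -lt0n fact_gt0.
Qed.

Lemma expmx_zero N (A : 'M[R]_N) (t : R) : A *m A = 0 ->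
  expmx (t *: A) = 1%:M + t *: A.
Proof.
move=> AA; apply: (@expmx_cvg _ _ 0).
- by rewrite AA raddf0.
- apply: cvg_near_cst; exists 1%N => // -[//|n] _.
  rewrite /series /= big_nat_recl// big1 ?addr0 => [|i _].
    by rewrite /= fact0 invr1 !expr0 !mulr1.
  by case: i => [|i]; [exact: mul0r|rewrite /= [0 ^+ _]expr0n !mulr0].
- apply: cvg_near_cst; exists 2%N => // -[//|[//|n]] _.
  rewrite /series /= !big_nat_recl// big1 ?addr0 => [|i _].
    have -> : (odd 0)%:R = 0 :> R by [].
    have -> : (odd 1)%:R = 1 :> R by [].
    by rewrite mul0r add0r invr1 expr1 expr0 mulr1 !mul1r.
  by rewrite /= [0 ^+ _]expr0n !mulr0.
Qed.

(** The even and odd parts of the series are the half-sum and half-difference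
    of the exponential series at kappa t and - kappa t. *)
Lemma expmx_pos N (A : 'M[R]_N) (kappa t : R) : 0 < kappa ->
  A *m A = (kappa ^+ 2)%:M ->
  expmx (t *: A) = ((expR (kappa * t) + expR (- (kappa * t))) / 2)%:M
     + (kappa^-1 * ((expR (kappa * t) - expR (- (kappa * t))) / 2)) *: A.
Proof.
move=> k0 AA; have kn0 : kappa != 0 by rewrite gt_eqF.
have cE x : series (exp_coeff x) @ \oo --> expR x by exact: is_cvg_series_exp_coeff.
have E j : (kappa ^+ 2) ^+ j = kappa ^+ j.*2 by rewrite -exprM mul2n.
have sE k : exp_coeff (- (kappa * t)) k = (-1) ^+ k * exp_coeff (kappa * t) k.
  by rewrite /exp_coeff /= [(- (kappa * t)) ^+ k]exprNn mulrA.
have cS (s : R) : (fun n => series (exp_coeff (kappa * t)) n + s * series (exp_coeff (- (kappa * t))) n) @ \oo --> expR (kappa * t) + s * expR (- (kappa * t)).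
  apply: cvgD; first exact: cE.
  by apply: cvgM; [exact: cvg_cst|exact: cE].
have ES (s : R) : (fun n => series (exp_coeff (kappa * t)) n + s * series (exp_coeff (- (kappa * t))) n) = series (fun k => (1 + s * (-1) ^+ k) * exp_coeff (kappa * t) k).
  apply/funext => n; rewrite /series /= mulr_sumr -big_split/=.
  by apply: eq_bigr => k _; rewrite sE; ring.
apply: (expmx_cvg AA).
- have -> : (expR (kappa * t) + expR (- (kappa * t))) / 2 =
      2^-1 * (expR (kappa * t) + 1 * expR (- (kappa * t))) by ring.
  have := cS 1; rewrite ES; apply: cvg_seriesZ => k.
  rewrite /exp_coeff /= E exprMn -signr_odd.
  case: (boolP (odd k)) => ok /=; first by rewrite expr1 mulrN1 subrr !mul0r mulr0.
  by rewrite [k in _ * kappa ^+ k](_ : _ = k) ?even_halfK//; field; rewrite pnatr_eq0 -lt0n fact_gt0.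
- have -> : kappa^-1 * ((expR (kappa * t) - expR (- (kappa * t))) / 2) =
      (kappa^-1 / 2) * (expR (kappa * t) + (- 1) * expR (- (kappa * t))) by ring.
  have := cS (- 1); rewrite ES; apply: cvg_seriesZ => k.
  rewrite /exp_coeff /= E exprMn -signr_odd.
  case: (boolP (odd k)) => ok /=; last by rewrite expr0 mulr1 subrr !mul0r mulr0.
  have -> : kappa ^+ k = kappa * kappa ^+ k./2.*2.
    by rewrite -exprS; congr (_ ^+ _); lia.
  by rewrite expr1 mulN1r opprK; field; rewrite kn0 pnatr_eq0 -lt0n fact_gt0.
Qed.

End Exponential.

(** * The algebra R[e]/(e^2 - lambda) and its action *)

Section Scalars.
Context {R : realType}.
Implicit Types (z w : R * R).

(** A pair (a, b) stands for a + b e with e^2 = lambda. *)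
Definition zmul (lam : R) z w := (z.1 * w.1 + lam * z.2 * w.2, z.1 * w.2 + z.2 * w.1).
Definition zconj z := (z.1, - z.2).
Definition znorm (lam : R) z := z.1 ^+ 2 - lam * z.2 ^+ 2.
(** The connected component of 1 in the set of elements of positive norm.
    For lambda >= 0 that set has a second component, consisting of the
    opposites, which the sign condition removes; for lambda < 0 it is connected. *)
Definition is_zpos (lam : R) z := 0 < znorm lam z /\ (0 <= lam -> 0 < z.1).
Definition is_zunit (lam : R) z := znorm lam z = 1 /\ (0 <= lam -> 0 < z.1).

Variable lam : R.

Lemma zmulC z w : zmul lam z w = zmul lam w z.
Proof. by rewrite /zmul; congr (_, _); ring. Qed.

Lemma zmulA z w u : zmul lam z (zmul lam w u) = zmul lam (zmul lam z w) u.
Proof. by rewrite /zmul /=; congr (_, _); ring. Qed.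

Lemma zmul1 z : zmul lam (1, 0) z = z.
Proof. by case: z => a b; rewrite /zmul /=; congr (_, _); ring. Qed.

Lemma zmul_conj z : zmul lam (zconj z) z = (znorm lam z, 0).
Proof. by rewrite /zmul /znorm /=; congr (_, _); ring. Qed.

Lemma znormM z w : znorm lam (zmul lam z w) = znorm lam z * znorm lam w.
Proof. by rewrite /zmul /znorm /=; ring. Qed.

Lemma znorm_conj z : znorm lam (zconj z) = znorm lam z.
Proof. by rewrite /znorm /= sqrrN. Qed.

Lemma zunit_zpos z : is_zunit lam z -> is_zpos lam z.
Proof. by move=> [n1 p]; split=> //; rewrite n1. Qed.

Lemma zpos_conj z : is_zpos lam z -> is_zpos lam (zconj z).
Proof. by move=> [n1 p]; split=> //; rewrite znorm_conj. Qed.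

Lemma zunit_conj z : is_zunit lam z -> is_zunit lam (zconj z).
Proof. by move=> [n1 p]; split=> //; rewrite znorm_conj. Qed.

Lemma zunit1 : is_zunit lam (1, 0).
Proof. by split=> //=; rewrite /znorm /=; ring. Qed.

(** For lambda >= 0 the point is the sign of a c + lambda b d: its product with
    a c - lambda b d is positive, and the two have the positive sum 2 a c. *)
Lemma zposM z w : is_zpos lam z -> is_zpos lam w -> is_zpos lam (zmul lam z w).
Proof.
move=> [nz pz] [nw pw]; split; first by rewrite znormM mulr_gt0.
move=> l0; move: (pz l0) (pw l0) nz nw; rewrite /znorm /=.
case: z {pz} => a b; case: w {pw} => c d /= a0 c0 nz nw.
rewrite ltNge; apply/negP => le0.
have ac0 : 0 < a * c by rewrite mulr_gt0.
have pos : 0 < (a * c + lam * b * d) * (a * c - lam * b * d).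
  have -> : (a * c + lam * b * d) * (a * c - lam * b * d) =
    (a ^+ 2 - lam * b ^+ 2) * c ^+ 2 + lam * b ^+ 2 * (c ^+ 2 - lam * d ^+ 2) by ring.
  apply: ltr_wpDr; last by rewrite mulr_gt0// exprn_gt0.
  by rewrite mulr_ge0 ?(ltW nw)// mulr_ge0 ?sqr_ge0.
have : 0 <= a * c - lam * b * d by lra.
move=> /(mulr_le0_ge0 le0); lra.
Qed.

Lemma zunitM z w : is_zunit lam z -> is_zunit lam w -> is_zunit lam (zmul lam z w).
Proof.
move=> Gz Gw; have [_ p] := zposM (zunit_zpos Gz) (zunit_zpos Gw); split=> //.
by move: Gz Gw => [nz _] [nw _]; rewrite znormM nz nw mulr1.
Qed.

Definition znormalize z := let s := (Num.sqrt (znorm lam z))^-1 in (s * z.1, s * z.2).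

Lemma zunit_normalize z : is_zpos lam z -> is_zunit lam (znormalize z).
Proof.
move=> [n0 p]; split=> [|/p z0]; last first.
  by rewrite /= mulr_gt0 ?invr_gt0 ?sqrtr_gt0.
have s2 : (Num.sqrt (znorm lam z))^-1 ^+ 2 = (znorm lam z)^-1.
  by rewrite exprVn sqr_sqrtr// ltW.
rewrite {1}/znorm /= !exprMn s2.
have -> : (znorm lam z)^-1 * z.1 ^+ 2 - lam * ((znorm lam z)^-1 * z.2 ^+ 2) = (znorm lam z)^-1 * znorm lam z.
  by rewrite {2 4}/znorm; ring.
by rewrite mulVf// gt_eqF.
Qed.

End Scalars.

Section Action.
Context {R : realType} {N : nat} (A : 'M[R]_N) (lam : R).
Hypothesis AA : A *m A = lam%:M.

Definition zact (z : R * R) (x : 'cV[R]_N) := z.1 *: x + z.2 *: (A *m x).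

Lemma zact1 x : zact (1, 0) x = x.
Proof. by rewrite /zact scale1r scale0r addr0. Qed.

Lemma zactM z w x : zact z (zact w x) = zact (zmul lam z w) x.
Proof.
rewrite /zact mulmxDr -!scalemxAr mulmxA AA mul_scalar_mx /zmul /=.
by apply/colP => i; rewrite !mxE; ring.
Qed.

Lemma mulmx_zact z x : A *m zact z x = zact z (A *m x).
Proof. by rewrite /zact mulmxDr -!scalemxAr. Qed.

Lemma zact_mulmx z x : (z.1%:M + z.2 *: A) *m x = zact z x.
Proof. by rewrite mulmxDl mul_scalar_mx -scalemxAl. Qed.

(** Together with the converse below, this identifies the one-parameter group
    with the group of units, so that no exponential appears afterwards. *)
Lemma expmx_zunit t : exists2 g, is_zunit lam g & expmx (t *: A) = g.1%:M + g.2 *: A.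
Proof.
have [l0|l0|l0] := ltgtP lam 0.
- have k0 : 0 < Num.sqrt (- lam) by rewrite sqrtr_gt0 oppr_gt0.
  have k2 : lam = - Num.sqrt (- lam) ^+ 2 by rewrite sqr_sqrtr ?opprK// oppr_ge0 ltW.
  have AA' := AA; rewrite k2 in AA'; move: k0 k2 AA'.
  set k := Num.sqrt _ => k0 k2 AA'.
  eexists (_, _); last exact: expmx_neg k0 AA'.
  split=> /=; last by rewrite leNgt l0.
  rewrite /znorm /= k2 -(cos2Dsin2 (k * t)).
  by field; rewrite gt_eqF.
- have k0 : 0 < Num.sqrt lam by rewrite sqrtr_gt0.
  have k2 : lam = Num.sqrt lam ^+ 2 by rewrite sqr_sqrtr// ltW.
  have AA' := AA; rewrite k2 in AA'; move: k0 k2 AA'.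
  set k := Num.sqrt _ => k0 k2 AA'.
  eexists (_, _); last exact: expmx_pos k0 AA'.
  split=> /= [|_]; last by rewrite divr_gt0// addr_gt0 ?expR_gt0.
  rewrite /znorm /= k2 expRN; field.
  by rewrite !gt_eqF// expR_gt0.
- have AA' := AA; rewrite l0 raddf0 in AA'.
  exists (1, t); last by rewrite expmx_zero.
  by split=> //=; rewrite /znorm /= l0; ring.
Qed.

Lemma zunit_expmx g : is_zunit lam g -> exists t, expmx (t *: A) = g.1%:M + g.2 *: A.
Proof.
case: g => a b [] /=; rewrite /znorm /=.
have [l0|l0|l0] := ltgtP lam 0.
- have k0 : 0 < Num.sqrt (- lam) by rewrite sqrtr_gt0 oppr_gt0.
  have k2 : lam = - Num.sqrt (- lam) ^+ 2 by rewrite sqr_sqrtr ?opprK// oppr_ge0 ltW.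
  have AA' := AA; rewrite k2 in AA'; move: k0 k2 AA'.
  set k := Num.sqrt _ => k0 k2 AA' n1 _.
  have n2 : (k * b) ^+ 2 = 1 - a ^+ 2 by rewrite -n1 k2; ring.
  have a1 : -1 <= a <= 1.
    have := sqr_ge0 (k * b); rewrite n2 subr_ge0 -ler_norml => a2.
    by rewrite -(@ler_pXn2r _ 2)// ?nnegrE// expr1n real_normK// num_real.
  have [b0|b0] := lerP 0 b.
    exists (acos a / k); rewrite (expmx_neg _ k0 AA').
    have -> : k * (acos a / k) = acos a by field; rewrite gt_eqF.
    rewrite acosK// sin_acos// -n2 sqrtr_sqr (ger0_norm (mulr_ge0 (ltW k0) b0)).
    by rewrite mulKf// gt_eqF.
  exists (- acos a / k); rewrite (expmx_neg _ k0 AA').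
  have -> : k * (- acos a / k) = - acos a by field; rewrite gt_eqF.
  rewrite cosN sinN acosK// sin_acos// -n2 sqrtr_sqr ltr0_norm; last by rewrite pmulr_rlt0.
  by rewrite opprK mulKf// gt_eqF.
- have k0 : 0 < Num.sqrt lam by rewrite sqrtr_gt0.
  have k2 : lam = Num.sqrt lam ^+ 2 by rewrite sqr_sqrtr// ltW.
  have AA' := AA; rewrite k2 in AA'; move: k0 k2 AA'.
  set k := Num.sqrt _ => k0 k2 AA' n1 /(_ isT) a0.
  (* In the eigenbasis of e the unit is (a + k b, a - k b), and both entries are positive. *)
  have prod1 : (a + k * b) * (a - k * b) = 1 by rewrite -n1 k2; ring.
  have p0 : 0 < a + k * b.
    rewrite ltNge; apply/negP => le0.
    have : 0 <= a - k * b by lra.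
    move=> /(mulr_le0_ge0 le0); lra.
  exists (ln (a + k * b) / k); rewrite (expmx_pos _ k0 AA').
  have -> : k * (ln (a + k * b) / k) = ln (a + k * b) by field; rewrite gt_eqF.
  rewrite expRN lnK ?posrE//.
  have -> : (a + k * b)^-1 = a - k * b.
    by apply: (mulfI (lt0r_neq0 p0)); rewrite prod1 divff// gt_eqF.
  by congr (_%:M + _ *: _); field; rewrite ?gt_eqF.
- rewrite l0 => n1 /(_ isT) a0.
  have AA' := AA; rewrite l0 raddf0 in AA'.
  exists b; rewrite expmx_zero//; congr (_%:M + _).
  have : a ^+ 2 == 1 by rewrite -n1; apply/eqP; ring.
  by rewrite sqrf_eq1 => /orP[/eqP//|/eqP]; lra.
Qed.

End Action.

(** * Subspaces and second countability *)

Section Topology.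

Lemma set_val_continuous (X : topologicalType) (S : set X) :
  continuous (@set_val X S).
Proof. exact: initial_continuous. Qed.

Lemma continuous_set_type (T X : topologicalType) (S : set X)
    (f : T -> set_type S) (x : T) :
  {for x, continuous (fun t => set_val (f t))} -> {for x, continuous f}.
Proof.
move=> cf A [_ [[B oB <-] Bfx] BA].
have : nbhs (set_val (f x)) B by exact: open_nbhs_nbhs.
move=> /cf fB; rewrite /nbhs /= /nbhs /=.
by apply: (@filterS T (nbhs x) _ _ _ _ fB) => t Bt; exact: BA.
Qed.

Lemma basis_nbhs (T : topologicalType) (B : set (set T)) :
  B `<=` open ->
  (forall x A, nbhs x A -> exists2 U, B U & U x /\ U `<=` A) -> basis B.
Proof.
move=> oB HB; split=> // x A /HB[U BU [Ux UA]]; exists U => //.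
Qed.

(** The balls with rational centres and radii 1/(n+1) form a countable basis. *)
Lemma second_countable_cV (R : realType) N : @second_countable 'cV[R]_N.
Proof.
pose F (p : 'cV[rat]_N * nat) : set 'cV[R]_N :=
  (ball (map_mx ratr p.1 : 'cV[R]_N) (p.2.+1%:R^-1 : R))°.
exists (range F).
  exact: sub_countable (card_image_le _ _) (countableP _).
apply: basis_nbhs => [_ [p _ <-]|x A]; first exact: open_interior.
move=> /nbhs_ballP[e /= e0 xA].
have [n] := ltr_add_invr (divr_gt0 e0 (ltr0n R 2)); rewrite add0r => ne.
set r := n.+1%:R^-1 in ne; have r0 : 0 < r / 2 by rewrite divr_gt0 ?invr_gt0.
(* Half the radius leaves room for x to be an interior point of the ball. *)
have rat_near (a : R) : exists p : rat, ball (ratr p : R) (r / 2) a.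
  have /rat_in_itvoo[p] : a - r / 2 < a + r / 2 by lra.
  by rewrite in_itv /= => /andP[? ?]; exists p; rewrite /ball/= ltr_norml; lra.
have [y xy] : exists y : 'cV[rat]_N, ball (map_mx ratr y : 'cV[R]_N) (r / 2) x.
  exists (\col_i sval (cid (rat_near (x i 0)))); split=> // i j.
  by rewrite !mxE (ord1 j); case: cid.
exists (F (y, n)); first by exists (y, n).
split.
  apply/nbhs_ballP; exists (r / 2) => //= z xz; rewrite [n.+1%:R^-1](splitr r).
  exact: ball_triangle xy xz.
move=> z /interior_subset yz; apply: xA.
rewrite (splitr e); apply: (@ball_triangle _ _ (map_mx ratr y : 'cV[R]_N)).
  apply: ball_sym; apply: le_ball xy.
  by rewrite (le_trans _ (ltW ne))// ler_pdivrMr// ler_peMr// ?ler1n// invr_ge0.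
exact: (le_ball (ltW ne)).
Qed.

Lemma second_countable_set_type (T : topologicalType) (S : set T) :
  @second_countable T -> @second_countable (set_type S).
Proof.
move=> [B cB [oB HB]]; exists ((fun U => @set_val T S @^-1` U) @` B).
  exact: sub_countable (card_image_le _ _) cB.
apply: basis_nbhs => [_ [U BU <-]|x A].
  by exists U => //; exact: oB.
move=> [_ [[V oV <-] Vx] VA].
have [U [BU Ux] UV] := HB (set_val x) V (open_nbhs_nbhs (conj oV Vx)).
exists (@set_val T S @^-1` U); first by exists U.
by split=> // y /UV/VA.
Qed.

Lemma second_countable_open_image (T T' : topologicalType) (f : T -> T') :
  continuous f -> (forall U, open U -> open (f @` U)) -> range f = setT ->
  @second_countable T -> @second_countable T'.
Proof.
move=> cf fo sf [B cB [oB HB]]; exists ((fun U => f @` U) @` B).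
  exact: sub_countable (card_image_le _ _) cB.
apply: basis_nbhs => [_ [U BU <-]|y A yA].
  by apply: fo; exact: oB.
have [x _ xy] : range f y by rewrite sf.
rewrite -xy in yA *; have [U [BU Ux] UV] := HB x (f @^-1` A) (cf x A yA).
exists (f @` U); first by exists U.
split; first by exists x.
by move=> _ [t Ut <-]; exact: UV.
Qed.

Lemma hausdorff_set_type (T : topologicalType) (S : set T) :
  hausdorff_space T -> hausdorff_space (set_type S).
Proof.
move=> hT x y xy; apply/val_inj/hT => A B xA yB.
have := xy (set_val @^-1` A) (set_val @^-1` B).
move=> /(_ (@set_val_continuous _ S x A xA) (@set_val_continuous _ S y B yB)) [z [Az Bz]].
by exists (set_val z).
Qed.

End Topology.

(** * Charts and embedded atlases *)

Section Charts.
Context {R : realType}.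

Lemma Cn_local k p (W : normedModType R) (U : set 'cV[R]_p) (f : 'cV[R]_p -> W) :
  (forall x, U x -> exists2 V : set 'cV[R]_p, open V /\ V x & Cn k V f) ->
  Cn k U f.
Proof.
elim: k f => [|k IH] f H.
  by move=> x Ux; have [V [oV Vx] cf] := H x Ux; exact: cf.
split=> [x Ux|v]; first by have [V [oV Vx] [df _]] := H x Ux; exact: df.
apply: IH => x Ux; have [V [oV Vx] [_ Df]] := H x Ux.
by exists V => //; exact: Df.
Qed.

Lemma smooth_onP p q (U : set 'cV[R]_p) (f : 'cV[R]_p -> 'cV[R]_q) :
  smooth_on U f <-> forall k, Cn k U f.
Proof. by split=> H k; apply/CkE; exact: H. Qed.

Definition charts_of (T : topologicalType) d (a : set (@chart R T d)) :=
  forall c, a c -> is_chart c.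

Definition covers (T : topologicalType) d (a : set (@chart R T d)) :=
  forall x, exists2 c, a c & chart_dom c x.

Lemma chart_imgP (T : Type) d (c : @chart R T d) x :
  chart_dom c x -> chart_img c (chart_map c x).
Proof. by exists x. Qed.

Lemma open_chart_image (T : topologicalType) d (c : @chart R T d) (W : set T) :
  is_chart c -> open W -> W `<=` chart_dom c -> open (chart_map c @` W).
Proof.
move=> [oD oI K _ ci] oW WD; rewrite openE => _ [x Wx <-].
have Dx := WD _ Wx; have Ix := chart_imgP Dx.
have nW : nbhs (chart_inv c (chart_map c x)) W.
  by rewrite K//; exact: open_nbhs_nbhs.
have nz : nbhs (chart_map c x) (chart_inv c @^-1` W) := ci _ Ix _ nW.
have nI : nbhs (chart_map c x) (chart_img c) by exact: open_nbhs_nbhs.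
rewrite /interior; apply: filterS (filterI nz nI) => z [/= Wz [y Dy yz]].
by exists y => //; move: Wz; rewrite -yz K.
Qed.

(** What the subspace atlas of a subset of R^N and the Euclidean atlas have in
    common: smoothness of maps into the manifold can be tested after the
    inclusion iota into R^N. *)
Definition embedded_atlas (T : topologicalType) d N (a : set (@chart R T d))
    (iota : T -> 'cV[R]_N) : Prop :=
  [/\ charts_of a,
      forall (T' : topologicalType) (f : T' -> T) x,
        {for x, continuous (fun t => iota (f t))} -> {for x, continuous f},
      continuous iota,
      forall c, a c -> smooth_on (chart_img c) (fun z => iota (chart_inv c z)) &
      forall c x, a c -> chart_dom c x ->
        exists (W : set 'cV[R]_N) (F : 'cV[R]_N -> 'cV[R]_d),
          [/\ open W, W (iota x), smooth_on W F &
              forall y, chart_dom c y -> W (iota y) ->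
                chart_map c y = F (iota y)]].

Lemma sub_atlas_embedded N d (S : set 'cV[R]_N) :
  embedded_atlas (sub_atlas d S) set_val.
Proof.
split.
- by move=> c [].
- by move=> T' f x H; apply: continuous_set_type; exact: H.
- exact: set_val_continuous.
- by move=> c [].
- by move=> c x [_ _]; apply.
Qed.

Lemma smooth_id p (U : set 'cV[R]_p) : smooth_on U id.
Proof. by apply/smooth_onP => k; exact: Cn_id. Qed.

Lemma euclidean_atlas_embedded N : embedded_atlas (@euclidean_atlas R N) id.
Proof.
split.
- move=> _ ->; split; first exact: openT.
  + rewrite /chart_img /= (_ : _ @` _ = setT); first exact: openT.
    by apply/seteqP; split=> // x _; exists x.
  + by [].
  + by move=> x _; exact: cvg_id.
  + by move=> x _; exact: cvg_id.
- by [].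
- by move=> x; exact: cvg_id.
- by move=> _ ->; exact: smooth_id.
- move=> _ x -> _; exists setT, id; split=> //; first exact: openT.
  exact: smooth_id.
Qed.

Section Embedded.
Context (T : topologicalType) d N (a : set (@chart R T d)) (iota : T -> 'cV[R]_N).
Hypothesis aE : embedded_atlas a iota.

Lemma embedded_chart_smooth c p (f : 'cV[R]_p -> T) (U : set 'cV[R]_p) :
  a c -> open U -> (forall z, U z -> chart_dom c (f z)) ->
  smooth_on U (fun z => iota (f z)) -> smooth_on U (fun z => chart_map c (f z)).
Proof.
move=> ac oU UD /smooth_onP sf; apply/smooth_onP => k.
have [_ _ _ _ loc] := aE.
apply: Cn_local => x Ux.
have [W [F [oW Wx /smooth_onP sF E]]] := loc c (f x) ac (UD _ Ux).
pose V := U `&` (fun z => iota (f z)) @^-1` W.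
have oV : open V.
  rewrite openE => z [Uz Wz]; apply: filterI; first exact: open_nbhs_nbhs.
  by apply: (sf 0%N z Uz); exact: open_nbhs_nbhs.
exists V => //.
apply: (@Cn_eq R p _ k V (fun z => F (iota (f z)))) => // [z [Uz Wz]|].
  by rewrite E//; exact: UD.
apply: (@Cn_comp R p N V W) => // [z []//|].
by apply: Cn_sub (sf k) => z [].
Qed.

Lemma embedded_smooth_atlas : covers a -> smooth_atlas a.
Proof.
have [ch _ _ si _] := aE; move=> cov; split=> // c c' ac ac'.
have cc := ch _ ac; have [oD _ K _ _] := cc; have [oD' _ _ _ _] := ch _ ac'.
apply: embedded_chart_smooth => //.
- by apply: open_chart_image => //; exact: openI.
- by move=> _ [x [Dx Dx'] <-]; rewrite K.
- apply/smooth_onP => k; move/smooth_onP: (si _ ac) => /(_ k).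
  by apply: Cn_sub => _ [x [Dx _] <-]; exists x.
Qed.

(** Continuity comes for free: iota o f is continuous in the charts of the
    source, and iota induces the topology of the target. *)
Lemma smooth_map_into_embedded (E : topologicalType) e (b : set (@chart R E e))
    (W : set E) (f : E -> T) :
  charts_of b -> covers b -> open W ->
  (forall c, b c -> smooth_on (chart_map c @` (W `&` chart_dom c))
     (fun z => iota (f (chart_inv c z)))) ->
  smooth_map_on b a W f.
Proof.
have [ch init ci si loc] := aE.
move=> chb cov oW sf.
have oWD c : b c -> open (W `&` chart_dom c).
  by move=> /chb[oD _ _ _ _]; exact: openI.
have cf x : W x -> {for x, continuous f}.
  move=> Wx; apply: init; have [c bc cx] := cov x.
  have := sf c bc; have cc := chb _ bc; have [oD oI K cm cinv] := cc.
  move=> /smooth_onP /(_ 0%N) /= /(_ (chart_map c x)) H.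
  have {}H : {for chart_map c x, continuous (fun z => iota (f (chart_inv c z)))}.
    by apply: H; exists x.
  have := continuous_comp (cm x cx) H.
  rewrite /prop_for /continuous_at /= (K x cx); apply: cvg_trans.
  apply: near_eq_cvg; near=> y; rewrite /= K//.
  near: y; exact: open_nbhs_nbhs.
split=> // c c' bc ac'.
have cc := chb _ bc; have [oD oI K cm cinv] := cc.
have oU : open (W `&` chart_dom c `&` f @^-1` chart_dom c').
  rewrite openE => x [[Wx cx] c'x]; apply: filterI.
    by apply: open_nbhs_nbhs; split=> //; exact: oWD.
  by apply: (cf x Wx); apply: open_nbhs_nbhs; split=> //; have [] := ch _ ac'.
apply: embedded_chart_smooth => //.
- by apply: open_chart_image => // x [[]].
- by move=> _ [x [[_ cx] c'x] <-]; rewrite K.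
- apply/smooth_onP => k; move/smooth_onP: (sf c bc) => /(_ k).
  by apply: Cn_sub => _ [x [[Wx cx] _] <-]; exists x.
Unshelve. all: by end_near.
Qed.

End Embedded.

End Charts.

(** * Product charts and quadrics *)

Section MoreCharts.
Context {R : realType}.

Lemma continuous_cV (T : topologicalType) N (f : T -> 'cV[R]_N) (x : T) :
  (forall i, {for x, continuous (fun t => f t i 0)}) -> {for x, continuous f}.
Proof.
move=> cf A [P nP PA].
have : \forall t \near x, forall i : 'I_N, P i 0 (f t i 0).
  by apply: filter_forall => i; exact: (cf i (P i 0) (nP i 0)).
apply: filterS => t Pt; apply: PA => i j; rewrite (ord1 j); exact: Pt.
Qed.

Lemma Cn_usubmx k p q (U : set 'cV[R]_(p + q)) : open U -> Cn k U (@usubmx R p q 1).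
Proof.
move=> oU; apply: Cn_vec => // i; under eq_fun do rewrite mxE.
exact/Cn_coord/Cn_id.
Qed.

Lemma Cn_dsubmx k p q (U : set 'cV[R]_(p + q)) : open U -> Cn k U (@dsubmx R p q 1).
Proof.
move=> oU; apply: Cn_vec => // i; under eq_fun do rewrite mxE.
exact/Cn_coord/Cn_id.
Qed.

Lemma continuous_usubmx p q : continuous (@usubmx R p q 1).
Proof. by move=> x; apply: (@Cn_usubmx 0%N p q setT openT). Qed.

Lemma continuous_dsubmx p q : continuous (@dsubmx R p q 1).
Proof. by move=> x; apply: (@Cn_dsubmx 0%N p q setT openT). Qed.

Lemma continuous_col_mx (T : topologicalType) p q (f : T -> 'cV[R]_p)
    (g : T -> 'cV[R]_q) (x : T) : {for x, continuous f} -> {for x, continuous g} ->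
  {for x, continuous (fun t => col_mx (f t) (g t))}.
Proof.
move=> cf cg; apply: continuous_cV => i; rewrite /prop_for /continuous_at.
have [j ->|j ->] := split_ordP i.
  rewrite col_mxEu (_ : (fun t => _) = (fun t => f t j 0)); last first.
    by apply/funext => t; rewrite col_mxEu.
  exact: (continuous_comp cf (@coord_continuous R p 1 j 0 _)).
rewrite col_mxEd (_ : (fun t => _) = (fun t => g t j 0)); last first.
  by apply/funext => t; rewrite col_mxEd.
exact: (continuous_comp cg (@coord_continuous R q 1 j 0 _)).
Qed.

Section Prod.
Context (T1 T2 : topologicalType) (d1 d2 : nat).

Lemma prod_chart_img (c1 : @chart R T1 d1) (c2 : @chart R T2 d2) :
  chart_img (prod_chart c1 c2) =
  [set z | chart_img c1 (usubmx z) /\ chart_img c2 (dsubmx z)].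
Proof.
apply/seteqP; split=> z.
  move=> [[x y] [/= cx cy] <-]; rewrite /= col_mxKu col_mxKd.
  by split; [exists x|exists y].
move=> [[x cx xz] [y cy yz]]; exists (x, y) => //=.
by rewrite xz yz vsubmxK.
Qed.

Lemma is_chart_prod (c1 : @chart R T1 d1) (c2 : @chart R T2 d2) :
  is_chart c1 -> is_chart c2 -> is_chart (prod_chart c1 c2).
Proof.
move=> [oD1 oI1 K1 cm1 ci1] [oD2 oI2 K2 cm2 ci2]; split.
- apply: openI.
    by apply: (@open_comp (T1 * T2)%type T1 fst) => // x _; exact: cvg_fst.
  by apply: (@open_comp (T1 * T2)%type T2 snd) => // x _; exact: cvg_snd.
- rewrite prod_chart_img; apply: openI.
    by apply: open_comp oI1 => x _; exact: continuous_usubmx.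
  by apply: open_comp oI2 => x _; exact: continuous_dsubmx.
- by move=> [x y] [/= Dx Dy]; rewrite col_mxKu col_mxKd K1// K2.
- move=> [x y] [/= Dx Dy]; apply: continuous_col_mx.
    by apply: continuous_comp; [exact: cvg_fst|exact: cm1].
  by apply: continuous_comp; [exact: cvg_snd|exact: cm2].
- move=> z; rewrite prod_chart_img => -[Iz1 Iz2].
  have c1c : {for z, continuous (fun z : 'cV[R]_(d1 + d2) => chart_inv c1 (usubmx z))}.
    by apply: continuous_comp; [exact: continuous_usubmx|exact: ci1].
  have c2c : {for z, continuous (fun z : 'cV[R]_(d1 + d2) => chart_inv c2 (dsubmx z))}.
    by apply: continuous_comp; [exact: continuous_dsubmx|exact: ci2].
  exact: (cvg_pair c1c c2c).
Qed.

Lemma charts_of_prod (a1 : set (@chart R T1 d1)) (a2 : set (@chart R T2 d2)) :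
  charts_of a1 -> charts_of a2 -> charts_of (prod_atlas a1 a2).
Proof.
by move=> ch1 ch2 _ [c1 [c2 [/ch1 ? /ch2 ? ->]]]; exact: is_chart_prod.
Qed.

Lemma covers_prod (a1 : set (@chart R T1 d1)) (a2 : set (@chart R T2 d2)) :
  covers a1 -> covers a2 -> covers (prod_atlas a1 a2).
Proof.
move=> cv1 cv2 [x y]; have [c1 ac1 c1x] := cv1 x; have [c2 ac2 c2y] := cv2 y.
by exists (prod_chart c1 c2) => //; exists c1, c2.
Qed.

End Prod.

Section Quadric.
Context (N d : nat) (q : 'cV[R]_N -> R).
Hypothesis (Nd : N = (1 + d)%N) (q_smooth : forall k, Cn k setT q).
Hypothesis (qZ : forall a x, q (a *: x) = a ^+ 2 * q x).
Let S : set 'cV[R]_N := [set x | q x = 1].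

(** Central projection from the origin onto the affine hyperplane h = 1, for h
    a linear form with h = 1 at the given point, charts the part of the quadric
    where h > 0.  Homogeneity of q gives the inverse y |-> y / sqrt(q(y)). *)
Lemma quadric_covers : covers (sub_atlas d S).
Proof.
move=> x0; have qx0 : q (set_val x0) = 1 by exact: (set_valP x0).
have q0 : q 0 = 0 by rewrite -(scale0r 0) qZ expr0n mul0r.
have /existsP[i0 xi0] : [exists i, set_val x0 i 0 != 0].
  apply: contra_eqT qx0 => /existsPn H.
  have -> : set_val x0 = 0.
    by apply/colP => i; have := H i; rewrite negbK mxE => /eqP.
  by rewrite q0 eq_sym oner_eq0.
set x1 := set_val x0 in qx0 xi0.
(* Any linear form not vanishing at the point would do; a nonzero coordinate is at hand. *)
pose phi : 'rV[R]_N := (x1 i0 0)^-1 *: delta_mx 0 i0.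
have phi1 : phi *m x1 = 1%:M.
  rewrite -scalemxAl -rowE; apply/rowP => j; rewrite !mxE (ord1 j) eqxx.
  by rewrite mulVf.
have [K [L [LK KL phiK Lx1]]] := complement_frame Nd phi1.
pose mk (x : 'cV[R]_N) : set_type S := insubd x0 x.
have mkK x : q x = 1 -> set_val (mk x) = x.
  by move=> qx; apply: insubdK; rewrite inE.
pose h (x : 'cV[R]_N) := (phi *m x) 0 0.
have phiE x : phi *m x = (h x)%:M by exact: mx11_scalar.
have h1 : h x1 = 1 by rewrite /h phi1 mxE eqxx.
pose lift (v : 'cV[R]_d) := x1 + K *m v.
have hlift v : h (lift v) = 1 by rewrite /h /lift mulmxDr mulmxA phiK mul0mx addr0 phi1 mxE eqxx.
have Llift v : L *m lift v = v by rewrite /lift mulmxDr Lx1 add0r mulmxA LK mul1mx.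
have hZ a x : h (a *: x) = a * h x by rewrite /h -scalemxAr mxE.
have liftL x : lift (L *m x) = x + (1 - h x) *: x1.
  rewrite /lift mulmxA KL mulmxBl mul1mx -mulmxA phiE mul_mx_scalar.
  by rewrite scalerBl scale1r addrCA.
pose m (x : 'cV[R]_N) := (h x)^-1 *: (L *m x).
pose n (v : 'cV[R]_d) := (Num.sqrt (q (lift v)))^-1 *: lift v.
have qn v : 0 < q (lift v) -> q (n v) = 1.
  move=> qv; rewrite qZ exprVn sqr_sqrtr ?(ltW qv)// mulVf// gt_eqF//.
have liftm x : h x != 0 -> lift (m x) = (h x)^-1 *: x.
  move=> hx; rewrite /m scalemxAr liftL hZ mulVf// subrr scale0r addr0//.
have nm x : q x = 1 -> 0 < h x -> 0 < q (lift (m x)) /\ n (m x) = x.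
  move=> qx hx; have hx0 : h x != 0 by rewrite gt_eqF.
  rewrite /n liftm// qZ qx mulr1; split.
    by rewrite exprn_gt0// invr_gt0.
  by rewrite sqrtr_sqr gtr0_norm ?invr_gt0// invrK scalerA divff// scale1r.
have hn v : 0 < q (lift v) -> 0 < h (n v).
  by move=> qv; rewrite hZ hlift mulr1 invr_gt0 sqrtr_gt0.
have mn v : 0 < q (lift v) -> m (n v) = v.
  move=> qv; have := hn v qv; rewrite /m /n hZ hlift mulr1 -scalemxAr Llift => p.
  by rewrite scalerA mulVf ?scale1r// gt_eqF.
pose c := @Chart R (set_type S) d [set x | 0 < h (set_val x)]
  (fun x => m (set_val x)) (fun v => mk (n v)).
have Sval (x : set_type S) : q (set_val x) = 1 by exact: (set_valP x).
have imgE : chart_img c = [set v | 0 < q (lift v)].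
  apply/seteqP; split=> v /=.
    by move=> [x /= hx <-]; have [] := nm _ (Sval x) hx.
  by move=> qv; exists (mk (n v)); rewrite /= mkK ?qn ?mn//; exact: hn.
have oTN := @openT 'cV[R]_N; have oTd := @openT 'cV[R]_d.
have sh k : Cn k setT h.
  by apply: (Cn_coord 0 oTN); apply: (Cn_mulmx _ oTN); exact: Cn_id.
have slift k : Cn k setT lift.
  apply: (CnD oTd); first exact: Cn_cst.
  by apply: (Cn_mulmx _ oTd); exact: Cn_id.
have sql k : Cn k setT (fun v => q (lift v)).
  by exact: (@Cn_comp_scalar R d N setT setT).
have oI : open [set v | 0 < q (lift v)].
  apply: (@open_comp _ _ (fun v => q (lift v)) [set y | 0 < y]); last exact: open_gt.
  by move=> v _; exact: (sql 0%N v I).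
have oW : open [set x | 0 < h x].
  apply: (@open_comp _ _ h [set y | 0 < y]); last exact: open_gt.
  by move=> v _; exact: (sh 0%N v I).
have sn k : Cn k [set v | 0 < q (lift v)] n.
  apply: CnZ => //; last exact: Cn_sub (slift k).
  by apply: Cn_inv_sqrt => //; exact: Cn_sub (sql k).
have sm k : Cn k [set x | 0 < h x] m.
  apply: CnZ => //; last by apply: (Cn_mulmx _ oW); exact: Cn_id.
  apply: Cn_inv => //; last exact: Cn_sub (sh k).
  by move=> x hx; rewrite gt_eqF.
have ss k : Cn k [set v | 0 < q (lift v)] (fun v => set_val (mk (n v))).
  by apply: Cn_eq (sn k) => // v qv; rewrite mkK// qn.
exists c; last by rewrite /= -/x1 h1.
split.
- split.
  + by exists [set x | 0 < h x].
  + by rewrite imgE.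
  + move=> x /= hx; have [p e] := nm _ (Sval x) hx; apply: val_inj.
    by rewrite -set_valE mkK ?qn.
  + move=> x /= hx; apply: (continuous_comp (@set_val_continuous _ S x)).
    exact: (sm 0%N _ hx).
  + rewrite imgE => v /= qv; apply: continuous_set_type; exact: (ss 0%N).
- rewrite imgE; apply/smooth_onP => k; exact: ss.
- move=> x /= hx; exists [set x | 0 < h x], m; split=> //.
  exact/smooth_onP.
Qed.

End Quadric.

End MoreCharts.

(** * The symplectic form and the orbits *)

Section OmegaTheory.
Context {R : realType} {m : nat}.
Local Notation N := (m + m)%N.
Implicit Types x y : 'cV[R]_N.

Lemma OmegaDr x y1 y2 : Omega x (y1 + y2) = Omega x y1 + Omega x y2.
Proof. by rewrite /Omega mulmxDr mxE. Qed.

Lemma OmegaZr a x y : Omega x (a *: y) = a * Omega x y.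
Proof. by rewrite /Omega -scalemxAr mxE. Qed.

Lemma OmegaC x y : Omega x y = - Omega y x.
Proof.
rewrite /Omega; set J := block_mx _ _ _ _.
have JT : J^T = - J.
  by rewrite /J tr_block_mx opp_block_mx !trmx0 trmx1 !linearN /= trmx1 opprK ?oppr0.
have tr11 (B : 'M[R]_1) : B 0 0 = (B^T) 0 0 by rewrite mxE.
by rewrite tr11 !trmx_mul trmxK JT mulNmx mulmxN mxE mulmxA.
Qed.

Lemma OmegaDl x1 x2 y : Omega (x1 + x2) y = Omega x1 y + Omega x2 y.
Proof. by rewrite OmegaC OmegaDr opprD -!OmegaC. Qed.

Lemma OmegaZl a x y : Omega (a *: x) y = a * Omega x y.
Proof. by rewrite OmegaC OmegaZr -mulrN -OmegaC. Qed.

Lemma Omegaxx x : Omega x x = 0.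
Proof. by have := OmegaC x x; lra. Qed.

Lemma Cn_Omega k p (U : set 'cV[R]_p) (f g : 'cV[R]_p -> 'cV[R]_N) :
  open U -> Cn k U f -> Cn k U g -> Cn k U (fun t => Omega (f t) (g t)).
Proof.
move=> oU cf cg; rewrite /Omega.
under eq_fun do rewrite -mulmxA mxE.
apply: Cn_sum => // i; apply: CnM => //.
  by under eq_fun do rewrite mxE; exact: Cn_coord.
by apply: Cn_coord => //; exact: Cn_mulmx.
Qed.

End OmegaTheory.

Section OrbitSpace.
Context {R : realType} {m : nat} (A : 'M[R]_(m + m)) (lam : R).
Hypotheses (A_sp : sp A) (AA : A *m A = lam%:M).
Local Notation N := (m + m)%N.
Local Notation S := (set_type (Sigma A)).
Local Notation M := (orbit_space A).
Local Notation pi := (orbit_proj A).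
Local Notation act := (zact A).
Implicit Types (x y u : 'cV[R]_N) (z w : R * R).

Lemma Omega_sp x y : Omega (A *m x) y = - Omega x (A *m y).
Proof. by apply/eqP; rewrite -addr_eq0; apply/eqP/A_sp. Qed.

Definition qform x := Omega x (A *m x).

(** The form h_u with values in R[e]/(e^2 - lambda), linear over that algebra in
    its second argument. *)
Definition zform u x : R * R := (Omega x (A *m u), Omega u x).

Local Notation q := qform.
Local Notation zc := zform.

Lemma mulmxAA x : A *m (A *m x) = lam *: x.
Proof. by rewrite mulmxA AA mul_scalar_mx. Qed.

Lemma zform_act u z x : zc u (act z x) = zmul lam z (zc u x).
Proof.
rewrite /zc /act /zmul /= OmegaDl OmegaDr !OmegaZl !OmegaZr.
rewrite Omega_sp mulmxAA OmegaZr (OmegaC x u).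
have -> : Omega u (A *m x) = Omega x (A *m u).
  by rewrite OmegaC Omega_sp opprK.
by congr (_, _); ring.
Qed.

Lemma zformZ u a x : zc u (a *: x) = (a * (zc u x).1, a * (zc u x).2).
Proof. by rewrite /zc OmegaZl OmegaZr. Qed.

Lemma zformD u x y : zc u (x + y) = ((zc u x).1 + (zc u y).1, (zc u x).2 + (zc u y).2).
Proof. by rewrite /zc OmegaDl OmegaDr. Qed.

Lemma zformxx u : q u = 1 -> zc u u = (1, 0).
Proof. by move=> qu; rewrite /zc -/(q u) qu Omegaxx. Qed.

Lemma qformZ a x : q (a *: x) = a ^+ 2 * q x.
Proof. by rewrite /q -scalemxAr OmegaZl OmegaZr; ring. Qed.

Lemma qform_act z x : q (act z x) = znorm lam z * q x.
Proof.
rewrite /q mulmx_zact /act !OmegaDl !OmegaDr !OmegaZl !OmegaZr.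
rewrite !mulmxAA !OmegaZr !Omegaxx Omega_sp /znorm; ring.
Qed.

Lemma qform_smooth k (U : set 'cV[R]_N) : open U -> Cn k U q.
Proof.
by move=> oU; apply: Cn_Omega => //; [exact: Cn_id|apply: Cn_mulmx => //; exact: Cn_id].
Qed.

Lemma zact_smooth k p (U : set 'cV[R]_p) (a b : 'cV[R]_p -> R) (f : 'cV[R]_p -> 'cV[R]_N) :
  open U -> Cn k U a -> Cn k U b -> Cn k U f -> Cn k U (fun t => act (a t, b t) (f t)).
Proof.
by move=> oU ca cb cf; apply: CnD => //; apply: CnZ => //; exact: Cn_mulmx.
Qed.

Lemma qform_Sigma (x : S) : q (set_val x) = 1.
Proof. exact: (set_valP x). Qed.

Lemma Sigma_orbitP (x y : S) :
  Defs.orbit x y <-> exists2 g, is_zunit lam g & set_val y = act g (set_val x).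
Proof.
split=> [[t yt]|[g Gg yg]].
  have [g Gg tg] := expmx_zunit AA t; exists g => //.
  by rewrite -zact_mulmx -tg; exact: yt.
by have [t tg] := zunit_expmx AA Gg; exists t; rewrite tg zact_mulmx; exact: yg.
Qed.

Lemma orbit_proj_eqP (x y : S) :
  pi x = pi y <-> exists2 g, is_zunit lam g & set_val y = act g (set_val x).
Proof.
rewrite -Sigma_orbitP; split.
  move=> /eqmodP /asboolP; rewrite /= => ->.
  by apply/Sigma_orbitP; exists (1, 0); rewrite ?zact1//; exact: zunit1.
move=> /Sigma_orbitP[g Gg yx]; apply/eqmodP/asboolP.
have xy : set_val x = act (zconj g) (set_val y).
  by rewrite yx (zactM AA) zmul_conj; have [-> _] := Gg; rewrite zact1.
apply/seteqP; split=> t /Sigma_orbitP[h Gh th]; apply/Sigma_orbitP.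
  exists (zmul lam h (zconj g)); first by apply: zunitM => //; exact: zunit_conj.
  by rewrite th xy (zactM AA).
exists (zmul lam h g); first exact: zunitM.
by rewrite th yx (zactM AA).
Qed.

Lemma orbit_proj_continuous : continuous pi.
Proof. exact: pi_continuous. Qed.

Lemma orbit_proj_surj b : exists x : S, pi x = b.
Proof. by exists (repr b); rewrite /orbit_proj reprK. Qed.

Section Point.
Variable s0 : S.

Definition Sigma_pt x : S := insubd s0 x.

Local Notation mk := Sigma_pt.

Lemma Sigma_ptK x : q x = 1 -> set_val (mk x) = x.
Proof. by move=> qx; apply: insubdK; rewrite inE. Qed.

Lemma zact_continuous g : is_zunit lam g ->
  continuous (fun x : S => mk (act g (set_val x))).
Proof.
move=> Gg x; apply: continuous_set_type.
rewrite (_ : (fun t => _) = (fun x : S => act g (set_val x))); last first.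
  by apply/funext => y; rewrite Sigma_ptK// qform_act qform_Sigma; have [-> _] := Gg; rewrite mulr1.
apply: continuous_comp; first exact: set_val_continuous.
apply: (@zact_smooth 0%N N setT (cst g.1) (cst g.2) id).
- exact: openT.
- exact: (@Cn_cst R N _ 0%N setT).
- exact: (@Cn_cst R N _ 0%N setT).
- exact: (@Cn_id R 0%N N setT).
- by [].
Qed.

(** The saturation of an open set is the union of its translates. *)
Lemma orbit_proj_open (U : set S) : open U -> open (pi @` U).
Proof.
move=> oU; rewrite /open /= /quotient_open.
rewrite (_ : _ @^-1` _ = \bigcup_(g in [set g | is_zunit lam g])
   ((fun x : S => mk (act g (set_val x))) @^-1` U)).
  apply: bigcup_open => g Gg; apply: open_comp oU => x _.
  exact: zact_continuous.
apply/seteqP; split=> x /=.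
  move=> [y Uy /esym/orbit_proj_eqP[g Gg yx]]; exists g => //=.
  by rewrite (_ : mk _ = y)//; apply/val_inj; rewrite -set_valE Sigma_ptK -yx// qform_Sigma.
move=> [g Gg /= Ux]; eexists; first exact: Ux.
symmetry; apply/orbit_proj_eqP; exists g => //.
by rewrite Sigma_ptK// qform_act qform_Sigma; have [-> _] := Gg; rewrite mulr1.
Qed.

End Point.

(** A pointwise form of the universal property of the quotient; it holds because
    the projection is open. *)
Lemma continuous_orbit_space (T : topologicalType) (f : M -> T) (x : S) :
  {for x, continuous (fun t : S => f (pi t))} -> {for pi x, continuous f}.
Proof.
move=> cf B fB; have := cf B fB; rewrite nbhsE => -[V [oV Vx] VB].
rewrite /nbhs /=.
have : nbhs (pi x) (pi @` V).
  apply: open_nbhs_nbhs; split; last by exists x.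
  exact: (orbit_proj_open x oV).
by apply: filterS => _ [y Vy <-]; exact: VB.
Qed.

Lemma second_countable_orbit_space : S -> @second_countable M.
Proof.
move=> s0; apply: (second_countable_open_image orbit_proj_continuous (orbit_proj_open s0)).
  by apply/seteqP; split=> // b _; have [x xb] := orbit_proj_surj b; exists x.
exact/second_countable_set_type/second_countable_cV.
Qed.

End OrbitSpace.

(** * Charts of the orbit space *)

Section OrbitManifold.
Context {R : realType} {m : nat} (A : 'M[R]_(m + m)) (lam : R).
Hypotheses (A_sp : sp A) (AA : A *m A = lam%:M).
Local Notation N := (m + m)%N.
Local Notation S := (set_type (Sigma A)).
Local Notation M := (orbit_space A).
Local Notation pi := (orbit_proj A).
Local Notation act := (zact A).
Local Notation zc := (zform A).
Local Notation q := (qform A).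
Implicit Types (x y u : 'cV[R]_N) (z w : R * R).

Lemma open_zpos p (f : 'cV[R]_p -> R * R) :
  continuous (fun t => (f t).1) -> continuous (fun t => (f t).2) ->
  open [set t | is_zpos lam (f t)].
Proof.
move=> c1 c2.
have cn : continuous (fun t => znorm lam (f t)).
  have -> : (fun t => znorm lam (f t)) =
      (fun t => (f t).1 * (f t).1 - lam * ((f t).2 * (f t).2)).
    by apply/funext => t; rewrite /znorm !expr2.
  move=> t; have c11 : {for t, continuous (fun t => (f t).1 * (f t).1)}.
    exact: (cvgM (c1 t) (c1 t)).
  have c22 : {for t, continuous (fun t => (f t).2 * (f t).2)}.
    exact: (cvgM (c2 t) (c2 t)).
  have c22' : {for t, continuous (fun t => lam * ((f t).2 * (f t).2))}.
    exact: (cvgM (cvg_cst lam) c22).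
  exact: (cvgB c11 c22').
have o1 : open [set t | 0 < (f t).1].
  by apply: (@open_comp _ _ (fun t => (f t).1) [set y | 0 < y]) => //; exact: open_gt.
have o2 : open [set t | 0 < znorm lam (f t)].
  by apply: (@open_comp _ _ (fun t => znorm lam (f t)) [set y | 0 < y]) => //; exact: open_gt.
have [l0|l0] := boolP (0 <= lam).
  rewrite (_ : [set t | _] = [set t | 0 < znorm lam (f t)] `&` [set t | 0 < (f t).1]).
    exact: openI.
  by apply/seteqP; split=> t /= [n p1]; split=> //; exact: p1.
rewrite (_ : [set t | _] = [set t | 0 < znorm lam (f t)])//.
by apply/seteqP; split=> t /=; [case|move=> n; split=> //; rewrite (negbTE l0)].
Qed.

Definition slice_dom u : set 'cV[R]_N := [set x | is_zpos lam (zc u x)].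

Local Notation U := slice_dom.

Lemma zform1_smooth k u (V : set 'cV[R]_N) : open V -> Cn k V (fun x => (zc u x).1).
Proof. by move=> oV; apply: Cn_Omega => //; [exact: Cn_id|exact: Cn_cst]. Qed.

Lemma zform2_smooth k u (V : set 'cV[R]_N) : open V -> Cn k V (fun x => (zc u x).2).
Proof. by move=> oV; apply: Cn_Omega => //; [exact: Cn_cst|exact: Cn_id]. Qed.

Lemma znorm_zform_smooth k u (V : set 'cV[R]_N) : open V ->
  Cn k V (fun x => znorm lam (zc u x)).
Proof.
move=> oV; apply: (@Cn_eq R N _ k V (fun x => (zc u x).1 * (zc u x).1 +
   (- lam) * ((zc u x).2 * (zc u x).2))) => // [x _|].
  by rewrite /znorm; ring.
have s1 := zform1_smooth k u oV; have s2 := zform2_smooth k u oV.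
by apply: CnD => //; apply: CnM => //; [exact: Cn_cst|exact: CnM].
Qed.

Lemma open_slice_dom u : open (U u).
Proof.
apply: open_zpos => x.
  by apply: (@zform1_smooth 0%N u setT (@openT _)).
by apply: (@zform2_smooth 0%N u setT (@openT _)).
Qed.

Arguments open_slice_dom : clear implicits.

Lemma slice_dom_act u g x : is_zunit lam g -> U u x -> U u (act g x).
Proof. by move=> Gg Ux; rewrite /U /= (zform_act A_sp AA); apply: zposM => //; exact: zunit_zpos. Qed.

Lemma slice_dom_center u : q u = 1 -> U u u.
Proof. by move=> qu; rewrite /U /= zformxx//; exact/zunit_zpos/zunit1. Qed.

(** The point h_u(x)^-1 x, the inverse being conj divided by the norm. *)
Definition slice u x := (znorm lam (zc u x))^-1 *: act (zconj (zc u x)) x.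

Local Notation sl := slice.

(** The factor g in h_u(g x) = g h_u(x) cancels the one in g x. *)
Lemma slice_act u g x : is_zunit lam g -> sl u (act g x) = sl u x.
Proof.
move=> [ng _]; rewrite /sl (zform_act A_sp AA) znormM ng mul1r; congr (_ *: _).
rewrite (zactM AA); congr act.
rewrite (_ : zmul _ _ _ = zmul lam (zmul lam (zconj g) g) (zconj (zc u x))).
  by rewrite zmul_conj ng zmul1.
by rewrite /zmul /zconj /=; congr (_, _); ring.
Qed.

Lemma slice_smooth k u : Cn k (U u) (sl u).
Proof.
have oU := open_slice_dom u.
apply: CnZ => //.
  apply: Cn_inv => //; last exact: znorm_zform_smooth.
  by move=> x [n _]; rewrite gt_eqF.
apply: (zact_smooth A (a := fun x => (zc u x).1) (b := fun x => - (zc u x).2)) => //.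
- exact: zform1_smooth.
- apply: (@Cn_eq R N _ k _ (fun x => (- 1) * (zc u x).2)) => // [x _|].
    by rewrite mulN1r.
  by apply: CnM => //; [exact: Cn_cst|exact: zform2_smooth].
- exact: Cn_id.
Qed.

Section Frame.
Context (d : nat).
Implicit Types (v : 'cV[R]_d).

(** K and L are inverse coordinates between R^d and the kernel W of h_u, with
    L extended by 0 on the line over R[e]/(e^2 - lambda) spanned by u. *)
Definition slice_frame u (K : 'M[R]_(N, d)) (L : 'M[R]_(d, N)) : Prop :=
  [/\ forall v, L *m (K *m v) = v,
      forall x, K *m (L *m x) = x - act (zc u x) u,
      forall v, zc u (K *m v) = (0, 0) &
      forall z, L *m act z u = 0].

Lemma slice_frame_exists u : N = (1 + 1 + d)%N -> q u = 1 -> exists K L, slice_frame u K L.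
Proof.
move=> Nd qu; pose J : 'M[R]_N := block_mx 0 1%:M (- 1%:M) 0.
pose phi : 'rV[R]_N := - (A *m u)^T *m J; pose mu : 'rV[R]_N := u^T *m J.
have phiE x : phi *m x = (zc u x).1%:M.
  rewrite [LHS]mx11_scalar; congr _%:M.
  by rewrite /zform /= OmegaC /Omega /phi !mulNmx mxE.
have muE x : mu *m x = (zc u x).2%:M by rewrite [LHS]mx11_scalar.
have Euu : zc u u = (1, 0) by exact: zformxx.
have EuA : zc u (A *m u) = (0, 1).
  rewrite /zform Omegaxx; congr (_, _); exact: qu.
have DC : col_mx phi mu *m row_mx u (A *m u) = 1%:M.
  have z0 : scalar_mx 0 = 0 :> 'M[R]_(1, 1) by rewrite raddf0.
  by rewrite mul_col_row !phiE !muE Euu EuA /= z0 -scalar_mx_block.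
have [K [L [LK KL DK LC]]] := complement_frame Nd DC.
have LCx : L *m u = 0 /\ L *m (A *m u) = 0.
  by move: LC; rewrite mul_mx_row -row_mx0 => /eq_row_mx.
exists K, L; split.
- by move=> v; rewrite mulmxA LK mul1mx.
- move=> x; rewrite mulmxA KL mulmxBl mul1mx -mulmxA mul_col_mx phiE muE.
  by rewrite mul_row_col !mul_mx_scalar.
- move=> v; have : col_mx phi mu *m (K *m v) = 0 by rewrite mulmxA DK mul0mx.
  rewrite mul_col_mx phiE muE -col_mx0 => /eq_col_mx[].
  case: (zc u _) => a b /= /matrixP/(_ 0 0) + /matrixP/(_ 0 0).
  by rewrite !mxE eqxx !mulr1n => -> ->.
- by move=> z; rewrite mulmxDr -!scalemxAr LCx.1 LCx.2 !scaler0 addr0.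
Qed.

Context (s0 : S).
Local Notation mk := (Sigma_pt s0).

Definition unslice u (K : 'M[R]_(N, d)) v := (Num.sqrt (q (u + K *m v)))^-1 *: (u + K *m v).

Local Notation sq := unslice.

(** The representative of an orbit is irrelevant, by [slice_act].  The base point
    s0 only makes the inverse total, through [Sigma_pt]. *)
Definition slice_chart u K L : @chart R M d :=
  Chart [set b | U u (set_val (repr b))]
        (fun b => L *m sl u (set_val (repr b)))
        (fun v => pi (mk (sq u K v))).

Local Notation mchart := slice_chart.

Lemma repr_orbit_proj (x : S) : exists2 g, is_zunit lam g & set_val (repr (pi x)) = act g (set_val x).
Proof.
have [H _] := orbit_proj_eqP AA x (repr (pi x)); apply: H.
by rewrite [RHS]reprK.
Qed.

Lemma slice_chart_domP u K L (x : S) : chart_dom (slice_chart u K L) (pi x) <-> U u (set_val x).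
Proof.
have [g Gg E] := repr_orbit_proj x; rewrite /= E; split; last exact: slice_dom_act.
move=> /(slice_dom_act (zunit_conj Gg)); rewrite (zactM AA) zmul_conj.
by have [-> _] := Gg; rewrite zact1.
Qed.

Lemma slice_chart_mapE u K L (x : S) :
  chart_map (mchart u K L) (pi x) = L *m sl u (set_val x).
Proof. by have [g Gg E] := repr_orbit_proj x; rewrite /= E slice_act. Qed.

Lemma qform_unslice u K v : 0 < q (u + K *m v) -> q (sq u K v) = 1.
Proof.
by move=> qv; rewrite qformZ exprVn sqr_sqrtr ?(ltW qv)// mulVf// gt_eqF.
Qed.

Context (u : 'cV[R]_N) (K : 'M[R]_(N, d)) (L : 'M[R]_(d, N)).
Hypotheses (qu : q u = 1) (uKL : slice_frame u K L).
Let c := slice_chart u K L.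
Let I0 : set 'cV[R]_d := [set v | 0 < q (u + K *m v)].

Lemma zform_lift v : zc u (u + K *m v) = (1, 0).
Proof. by have [_ _ H _] := uKL; rewrite zformD H zformxx// !addr0. Qed.

Lemma unslice_dom v : I0 v -> U u (sq u K v).
Proof.
move=> qv; rewrite /U /= zformZ zform_lift /= mulr1 mulr0.
have s0p : 0 < (Num.sqrt (q (u + K *m v)))^-1 by rewrite invr_gt0 sqrtr_gt0.
split=> //=; by rewrite /znorm /= expr0n mulr0 subr0 exprn_gt0.
Qed.

Lemma unsliceK v : I0 v -> L *m sl u (sq u K v) = v.
Proof.
move=> qv; have s0p : 0 < (Num.sqrt (q (u + K *m v)))^-1 by rewrite invr_gt0 sqrtr_gt0.
rewrite /sl zformZ zform_lift /= mulr1 mulr0 /sq; move: s0p; set r := (Num.sqrt _)^-1 => r0.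
rewrite /znorm /act /= expr0n mulr0 subr0 oppr0 scale0r addr0 !scalerA.
rewrite [X in X *: _](_ : _ = 1) ?scale1r; last by field; rewrite gt_eqF.
have [LK _ _ Lu] := uKL; rewrite mulmxDr LK -[u in L *m u](zact1 A) Lu add0r//.
Qed.

Lemma slice_lift x : U u x -> u + K *m (L *m sl u x) = sl u x.
Proof.
move=> [n0 _]; have [_ KL _ _] := uKL; rewrite KL.
have -> : zc u (sl u x) = (1, 0).
  by rewrite /sl zformZ (zform_act A_sp AA) zmul_conj /= mulr0 mulVf// gt_eqF.
by rewrite zact1 addrC subrK.
Qed.

Lemma qform_slice x : q x = 1 -> U u x -> 0 < q (sl u x).
Proof.
move=> qx [n0 _]; rewrite /sl qformZ (qform_act A_sp AA) znorm_conj qx mulr1.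
by rewrite mulr_gt0// exprn_gt0// invr_gt0.
Qed.

(** Both points are positive multiples of h_u(x)^-1 x up to a unit: normalising
    by sqrt(q) instead of by the algebra changes x by the unit conj h_u(x)
    divided by the square root of its norm. *)
Lemma slice_unslice x : q x = 1 -> U u x ->
  exists2 g, is_zunit lam g & sq u K (L *m sl u x) = act g x.
Proof.
move=> qx Ux; rewrite /sq slice_lift//; exists (znormalize lam (zconj (zc u x))).
  exact/zunit_normalize/zpos_conj.
have [n0 _] := Ux; rewrite /sl qformZ (qform_act A_sp AA) znorm_conj qx mulr1.
rewrite /znormalize znorm_conj /act /= scalerDr !scalerA.
move: n0; set n := znorm lam _ => n0.
have s0n : Num.sqrt n != 0 by rewrite gt_eqF// sqrtr_gt0.
have -> : Num.sqrt (n^-1 ^+ 2 * n) = (Num.sqrt n)^-1.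
  rewrite expr2 -mulrA mulVf ?mulr1 ?gt_eqF//.
  by rewrite sqrtrV// ltW.
have nn : n^-1 = (Num.sqrt n)^-1 * (Num.sqrt n)^-1.
  by rewrite -invfM -expr2 sqr_sqrtr// ltW.
by rewrite invrK scalerDr !scalerA nn; congr (_ *: _ + _ *: _); field.
Qed.

Lemma slice_chart_img : chart_img c = I0.
Proof.
apply/seteqP; split=> v.
  move=> [b Db <-]; have [x xb] := orbit_proj_surj b; rewrite -xb in Db *.
  move/slice_chart_domP: Db => Ux; rewrite slice_chart_mapE /I0 /= slice_lift//.
  by apply: qform_slice => //; exact: qform_Sigma.
move=> qv; exists (pi (mk (sq u K v))).
  by apply/slice_chart_domP; rewrite Sigma_ptK ?qform_unslice//; exact: unslice_dom.
by rewrite slice_chart_mapE Sigma_ptK ?qform_unslice// unsliceK.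
Qed.

Lemma lift_smooth k (V : set 'cV[R]_d) : open V -> Cn k V (fun v => u + K *m v).
Proof.
move=> oV; apply: CnD => //; first exact: Cn_cst.
by apply: Cn_mulmx => //; exact: Cn_id.
Qed.

Lemma open_lift_pos : open I0.
Proof.
apply: (@open_comp _ _ (fun v => q (u + K *m v)) [set y | 0 < y]); last exact: open_gt.
have sq0 : Cn 0 setT (fun v => q (u + K *m v)).
  apply: (@Cn_comp_scalar R d N setT setT) => //; try exact: openT.
  - by apply: lift_smooth; exact: openT.
  - by apply: qform_smooth; exact: openT.
by move=> v _; exact: (sq0 v I).
Qed.

Lemma unslice_smooth k : Cn k I0 (sq u K).
Proof.
have oI := open_lift_pos.
apply: CnZ => //; last exact: lift_smooth.
apply: Cn_inv_sqrt => //.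
apply: (@Cn_comp_scalar R d N I0 setT) => //; try exact: openT.
  exact: lift_smooth.
by apply: qform_smooth; exact: openT.
Qed.

Lemma Sigma_pt_unslice_smooth k : Cn k I0 (fun v => set_val (mk (sq u K v))).
Proof.
apply: Cn_eq (unslice_smooth k); first exact: open_lift_pos.
by move=> v Iv; rewrite Sigma_ptK// qform_unslice.
Qed.

Lemma is_chart_slice : is_chart c.
Proof.
have oD : open (chart_dom c).
  rewrite /open /= /quotient_open.
  rewrite (_ : _ @^-1` _ = (@set_val _ (Sigma A)) @^-1` U u).
    by exists (U u) => //; exact: open_slice_dom.
  apply/seteqP; split=> x.
    exact: (slice_chart_domP u K L x).1.
  exact: (slice_chart_domP u K L x).2.
split; first exact: oD.
- by rewrite slice_chart_img; exact: open_lift_pos.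
- move=> b; have [x <-] := orbit_proj_surj b => /slice_chart_domP Ux.
  rewrite slice_chart_mapE; apply/esym/(orbit_proj_eqP AA).
  have [g Gg E] := slice_unslice (qform_Sigma x) Ux; exists g => //.
  rewrite Sigma_ptK// qform_unslice//= slice_lift//; apply: qform_slice => //; exact: qform_Sigma.
- move=> b; have [x <-] := orbit_proj_surj b => /slice_chart_domP Ux.
  apply: (continuous_orbit_space A_sp AA).
  rewrite (_ : (fun t : S => _) = (fun t : S => L *m sl u (set_val t))); last first.
    by apply/funext => t; rewrite slice_chart_mapE.
  have cL := Cn_mulmx L (open_slice_dom u) (@slice_smooth 0%N u) _ Ux.
  exact: (continuous_comp (@set_val_continuous _ (Sigma A) x) cL).
- move=> v; rewrite slice_chart_img => Iv.
  apply: (continuous_comp (f := fun v => mk (sq u K v))).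
    by apply: continuous_set_type; exact: (Sigma_pt_unslice_smooth 0%N).
  exact: orbit_proj_continuous.
Qed.

End Frame.

End OrbitManifold.

(** * The orbit space as a manifold and the submersion *)

Section OrbitAtlas.
Context {R : realType} {m : nat} (A : 'M[R]_(m + m)) (lam : R).
Hypotheses (A_sp : sp A) (AA : A *m A = lam%:M).
Local Notation N := (m + m)%N.
Local Notation S := (set_type (Sigma A)).
Local Notation M := (orbit_space A).
Local Notation pi := (orbit_proj A).
Local Notation act := (zact A).
Local Notation zc := (zform A).
Local Notation q := (qform A).
Local Notation U := (slice_dom A lam).
Local Notation sl := (slice A lam).
Implicit Types (x y u : 'cV[R]_N) (z w : R * R).

(** The pair (x, y) is encoded as one column so that continuity follows from the
    calculus of C^k maps. *)
Definition orbit_defect (w : 'cV[R]_(N + N)) : 'cV[R]_N :=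
  dsubmx w - act (zc (usubmx w) (dsubmx w)) (usubmx w).

Definition zform_pair1 (w : 'cV[R]_(N + N)) : R := (zc (usubmx w) (dsubmx w)).1.

Lemma zform_pair1_continuous : continuous zform_pair1.
Proof.
have oT := @openT 'cV[R]_(N + N); have su := Cn_usubmx 0 oT; have sd := Cn_dsubmx 0 oT.
have s1 : Cn 0 setT zform_pair1 by apply: (Cn_Omega oT sd); exact: Cn_mulmx.
by move=> w; exact: (s1 w I).
Qed.

Lemma orbit_defect_continuous : continuous orbit_defect.
Proof.
have oT := @openT 'cV[R]_(N + N); have su := Cn_usubmx 0 oT; have sd := Cn_dsubmx 0 oT.
have s2 : Cn 0 setT (fun w : 'cV[R]_(N + N) => (zc (usubmx w) (dsubmx w)).2).
  exact: Cn_Omega.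
have s1 : Cn 0 setT zform_pair1 by move=> w _; exact: zform_pair1_continuous.
have sa := zact_smooth A oT s1 s2 su.
have sd' : Cn 0 setT orbit_defect.
  by move=> w Tw; exact: (cvgB (sd w Tw) (sa w Tw)).
by move=> w; exact: (sd' w I).
Qed.

Lemma orbit_proj_eq_zform (x y : S) : pi x = pi y ->
  is_zunit lam (zc (set_val x) (set_val y)) /\
  set_val y = act (zc (set_val x) (set_val y)) (set_val x).
Proof.
move=> /(orbit_proj_eqP AA)[g Gg ->].
have -> : zc (set_val x) (act g (set_val x)) = g.
  by rewrite (zform_act A_sp AA) (zformxx (qform_Sigma x)) zmulC zmul1.
by [].
Qed.

(** If the orbits of x and y cannot be separated, related pairs (x', y') exist
    arbitrarily close to (x, y), the projection being open.  Passing to the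
    limit in y' = h_x'(y') x' gives y = h_x(y) x, so that h_x(y) has norm 1.  When
    lambda >= 0, its first component is a limit of positive numbers, and it is
    not 0 because the norm is 1. *)
Lemma hausdorff_orbit_space : hausdorff_space M.
Proof.
move=> b b'; have [x <-] := orbit_proj_surj b; have [y <-] := orbit_proj_surj b'.
move=> cl; pose W := col_mx (set_val x) (set_val y).
have near_related (P : set 'cV[R]_(N + N)) : nbhs W P ->
  exists x' y' : S, pi x' = pi y' /\ P (col_mx (set_val x') (set_val y')).
  move=> WP; have cW : {for (x, y), continuous (fun t : S * S => col_mx (set_val t.1) (set_val t.2))}.
    apply: continuous_col_mx.
      by apply: continuous_comp; [exact: cvg_fst|exact: set_val_continuous].
    by apply: continuous_comp; [exact: cvg_snd|exact: set_val_continuous].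
  have [[B B'] /= [Bx By] BP] := cW _ WP.
  have piN (t : S) (V : set S) : nbhs t V -> nbhs (pi t) (pi @` V).
    rewrite nbhsE => -[V' [oV' V't] V'V].
    apply: (@filterS _ (nbhs (pi t)) _ (pi @` V')); first exact: image_subset.
    by apply: open_nbhs_nbhs; split; [exact: (orbit_proj_open A_sp AA t)|exists t].
  have [_ [[x' Bx' <-] [y' By' yx']]] := cl _ _ (piN _ _ Bx) (piN _ _ By).
  by exists x', y'; split=> //; exact: (BP (x', y')).
have dW : orbit_defect W = 0.
  apply: contrapT => dW0; have oD : open (~` [set 0 : 'cV[R]_N]).
    by apply/closed_openC/accessible_closed_set1/hausdorff_accessible/norm_hausdorff.
  have nD : nbhs (orbit_defect W) (~` [set 0 : 'cV[R]_N]) by exact: open_nbhs_nbhs.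
  have [x' [y' [/orbit_proj_eq_zform[_ E] /=]]] := near_related _ (orbit_defect_continuous nD).
  by apply; rewrite /orbit_defect col_mxKu col_mxKd -E subrr.
move: dW; rewrite /orbit_defect col_mxKu col_mxKd => /eqP; rewrite subr_eq0 => /eqP yx.
apply/(orbit_proj_eqP AA); exists (zc (set_val x) (set_val y)) => //.
have nz : znorm lam (zc (set_val x) (set_val y)) = 1.
  by have := qform_Sigma y; rewrite {1}yx (qform_act A_sp AA) qform_Sigma mulr1.
split=> // l0; rewrite ltNge le_eqVlt; apply/negP => /orP[/eqP z0|z0].
  have : 0 <= lam * (zc (set_val x) (set_val y)).2 ^+ 2 by rewrite mulr_ge0 ?sqr_ge0.
  by move: nz; rewrite /znorm z0 expr0n /=; lra.
(* For lambda >= 0 this excludes that y lies in the orbit of - x. *)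
have nD : nbhs (zform_pair1 W) [set d : R | d < 0].
  by apply: open_nbhs_nbhs; split; [exact: open_lt|rewrite /zform_pair1 /W /= col_mxKu col_mxKd].
have [x' [y' [/orbit_proj_eq_zform[[_ /(_ l0) p] _] /=]]] := near_related _ (zform_pair1_continuous nD).
by rewrite /zform_pair1 col_mxKu col_mxKd ltNge ltW.
Qed.

Section Atlas.
Context (d : nat) (Nd : N = (1 + 1 + d)%N) (s0 : S).
Local Notation mk := (Sigma_pt s0).
Local Notation mchart := (@slice_chart R m A lam d s0).
Local Notation sigma_atlas := (sub_atlas d.+1 (Sigma A)).

Definition orbit_atlas : set (chart M d) :=
  [set c | exists u K L, [/\ q u = 1, slice_frame A u K L & c = mchart u K L]].

Lemma charts_orbit_atlas : charts_of orbit_atlas.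
Proof. by move=> _ [u [K [L [qu uKL ->]]]]; exact: is_chart_slice. Qed.

Lemma covers_orbit_atlas : covers orbit_atlas.
Proof.
move=> b; have [x <-] := orbit_proj_surj b.
have [K [L uKL]] := slice_frame_exists Nd (qform_Sigma x).
exists (mchart (set_val x) K L).
  by exists (set_val x), K, L; split=> //; exact: qform_Sigma.
by apply/(slice_chart_domP A_sp AA); apply: slice_dom_center; exact: qform_Sigma.
Qed.

(** Seen from the hypersurface, a chart of the quotient is the restriction of a
    smooth map defined on an open subset of the ambient space. *)
Lemma slice_chart_proj_smooth k p (V : set 'cV[R]_p) (f : 'cV[R]_p -> S) u K L :
  open V -> (forall t, V t -> U u (set_val (f t))) ->
  Cn k V (fun t => set_val (f t)) ->
  Cn k V (fun t => chart_map (mchart u K L) (pi (f t))).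
Proof.
move=> oV VU sf.
apply: (@Cn_eq R p _ k V (fun t => L *m sl u (set_val (f t)))) => //.
  by move=> t Vt; rewrite (slice_chart_mapE A_sp AA).
apply: Cn_mulmx => //.
exact: (Cn_comp oV (@open_slice_dom R m A lam u) VU sf (@slice_smooth R m A lam k u)).
Qed.

Lemma orbit_smooth_atlas : smooth_atlas orbit_atlas.
Proof.
have ch := charts_orbit_atlas.
split=> //; first exact: covers_orbit_atlas.
move=> _ _ [u [K [L [qu uKL ->]]]] [u' [K' [L' [qu' uKL' ->]]]].
set c := mchart u K L; set c' := mchart u' K' L'.
have cc : is_chart c by exact: is_chart_slice.
have cc' : is_chart c' by exact: is_chart_slice.
have VI : chart_map c @` (chart_dom c `&` chart_dom c') `<=` [set v | 0 < q (u + K *m v)].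
  rewrite -(slice_chart_img A_sp AA s0 qu uKL) => _ [b [Db _] <-]; exact: chart_imgP.
have oV : open (chart_map c @` (chart_dom c `&` chart_dom c')).
  apply: open_chart_image => //; apply: openI.
    by have [] := cc.
  by have [] := cc'.
have VU v : (chart_map c @` (chart_dom c `&` chart_dom c')) v ->
    U u' (set_val (mk (unslice A u K v))).
  move=> [b [Db Db'] bv].
  apply: (slice_chart_domP A_sp AA s0 u' K' L' (mk (unslice A u K v))).1.
  change (chart_dom c' (chart_inv c v)).
  by have [_ _ Kc _ _] := cc; rewrite -bv Kc.
apply/smooth_onP => k.
have sk := Cn_sub VI (Sigma_pt_unslice_smooth s0 u K k).
exact: (@slice_chart_proj_smooth k d _ (fun v => mk (unslice A u K v)) u' K' L' oV VU sk).
Qed.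

Lemma is_manifold_orbit_space : is_manifold orbit_atlas.
Proof.
split; first exact: hausdorff_orbit_space.
  exact: (second_countable_orbit_space A_sp AA).
exact: orbit_smooth_atlas.
Qed.

Lemma covers_Sigma : covers sigma_atlas.
Proof.
apply: (@quadric_covers R N d.+1 q).
- by rewrite Nd; lia.
- by move=> k; apply: qform_smooth; exact: openT.
- exact: qformZ.
Qed.

Lemma Sigma_embedded : embedded_atlas sigma_atlas set_val.
Proof. exact: sub_atlas_embedded. Qed.

Lemma is_manifold_Sigma : is_manifold sigma_atlas.
Proof.
split.
- by apply: hausdorff_set_type; exact: norm_hausdorff.
- exact/second_countable_set_type/second_countable_cV.
- exact: (embedded_smooth_atlas Sigma_embedded covers_Sigma).
Qed.

Lemma proj_smooth : smooth_map_on sigma_atlas orbit_atlas setT pi.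
Proof.
have [ch _ _ si _] := Sigma_embedded.
split; first by move=> x _; exact: orbit_proj_continuous.
move=> c _ ac [u [K [L [qu uKL ->]]]]; set c' := mchart u K L.
have cc : is_chart c by exact: ch.
have [oD oI Kc cm ci] := cc.
have cc' : is_chart c' by exact: is_chart_slice.
have oV : open (setT `&` chart_dom c `&` pi @^-1` chart_dom c').
  rewrite setTI; apply: openI => //.
  by apply: open_comp; [move=> x _; exact: orbit_proj_continuous|have [] := cc'].
apply/smooth_onP => k; apply: slice_chart_proj_smooth.
- by apply: open_chart_image => // x [[]].
- by move=> _ [x [[_ Dx] Dx'] <-]; rewrite Kc//; exact: (slice_chart_domP A_sp AA s0 u K L x).1.
- have /smooth_onP sik := si c ac.
  by apply: Cn_sub (sik k) => _ [x [[_ Dx] _] <-]; exact: chart_imgP.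
Qed.

(** The inverse of a chart of the quotient lifts to the hypersurface; after
    translation by a unit the lift passes through the given point x.  The chain
    rule applied to this section shows that the differential is onto. *)
Lemma proj_submersion : submersion sigma_atlas orbit_atlas pi.
Proof.
split; first exact: proj_smooth.
move=> c c' x ac ac' Dx Dx' w.
have [ch _ _ si loc] := Sigma_embedded.
have cc : is_chart c by exact: ch.
have [oD oI Kc cm ci] := cc.
have [_ /(_ c c' ac ac')/smooth_onP/(_ 1%N)[df _]] := proj_smooth.
have {}df : differentiable (in_charts pi c c') (chart_map c x) by apply: df; exists x.
case: ac' df Dx' => u [K [L [qu uKL ->]]] df Dx'.
set c1 := mchart u K L in df Dx' *.
have Ux : U u (set_val x) by exact: (slice_chart_domP A_sp AA s0 u K L x).1.
pose I0 := [set v | 0 < q (u + K *m v)].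
have [g Gg gE] := slice_unslice A_sp AA uKL (qform_Sigma x) Ux.
set v0 := L *m sl u (set_val x) in gE.
have Iv0 : I0 v0.
  by rewrite /I0 /= (slice_lift A_sp AA uKL Ux); apply: (qform_slice A_sp AA (qform_Sigma x) Ux).
(* The unit g carries x to the lift of its image, so conj g carries that lift back to x. *)
pose f v := mk (act (zconj g) (unslice A u K v)).
have qf v : I0 v -> q (act (zconj g) (unslice A u K v)) = 1.
  by move=> Iv; rewrite (qform_act A_sp AA) znorm_conj qform_unslice//; have [-> _] := Gg; rewrite mulr1.
have fv0 : f v0 = x.
  apply/val_inj; rewrite -!set_valE Sigma_ptK ?qf// gE (zactM AA) zmul_conj.
  by have [-> _] := Gg; rewrite zact1.
have oI0 : open I0 := @open_lift_pos R m A d u K.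
have sf k : Cn k I0 (fun v => set_val (f v)).
  apply: (@Cn_eq R d _ k I0 (fun v => act (zconj g) (unslice A u K v))) => //.
    by move=> v Iv; rewrite Sigma_ptK// qf.
  apply: (zact_smooth A (a := cst (zconj g).1) (b := cst (zconj g).2)) => //; try exact: Cn_cst.
  exact: unslice_smooth.
pose V := I0 `&` f @^-1` chart_dom c.
have oV : open V.
  rewrite openE => v [Iv Dv]; apply: filterI; first exact: open_nbhs_nbhs.
  have cf : {for v, continuous f} by apply: continuous_set_type; exact: (sf 0%N).
  by apply: cf; exact: open_nbhs_nbhs.
have Vv0 : V v0 by split=> //=; rewrite fv0.
have sV : smooth_on V (fun v => chart_map c (f v)).
  apply: (embedded_chart_smooth Sigma_embedded ac oV) => [v []//|].
  by apply/smooth_onP => k; apply: Cn_sub (sf k) => v [].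
have {}sV : differentiable (fun v => chart_map c (f v)) v0.
  by have /smooth_onP/(_ 1%N)[H _] := sV; exact: H.
have inv : \forall v \near v0, in_charts pi c c1 (chart_map c (f v)) = v.
  have : nbhs v0 V by exact: open_nbhs_nbhs.
  apply: filterS => v [Iv Dv]; rewrite /in_charts /= -/(chart_map c1 _).
  rewrite Kc//.
  have [g' Gg' gE'] := repr_orbit_proj AA (f v).
  rewrite gE' (slice_act A_sp AA)// Sigma_ptK ?qf// (slice_act A_sp AA) ?unsliceK//; last exact: zunit_conj.
exists ('d (fun v => chart_map c (f v)) v0 w).
have df' : differentiable (in_charts pi c c1) (chart_map c (f v0)) by rewrite fv0.
have := diff_comp sV df'; rewrite fv0 => /(congr1 (fun h => h w)) /= <-.
have dcomp := differentiable_comp sV df'.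
rewrite -[LHS]deriveE//.
transitivity ('D_w id v0); last by rewrite derive_id.
exact: near_eq_derive.
Qed.

End Atlas.

End OrbitAtlas.

(** * Trivialisations from equivariant maps *)

Section Trivialisation.
Context {R : realType} {m : nat} (A : 'M[R]_(m + m)) (lam : R).
Hypotheses (A_sp : sp A) (AA : A *m A = lam%:M).
Local Notation N := (m + m)%N.
Local Notation S := (set_type (Sigma A)).
Local Notation M := (orbit_space A).
Local Notation pi := (orbit_proj A).
Local Notation act := (zact A).
Local Notation q := (qform A).
Implicit Types (x u : 'cV[R]_N) (w g : R * R).

Context (d : nat) (Nd : N = (1 + 1 + d)%N) (s0 : S).
Local Notation mk := (Sigma_pt s0).
Local Notation aS := (sub_atlas d.+1 (Sigma A)).
Local Notation aM := (@orbit_atlas R m A lam d s0).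

Context (F : topologicalType) (e r : nat) (aF : set (@chart R F e)) (iota : F -> 'cV[R]_r).
Hypotheses (aF_emb : embedded_atlas aF iota) (aF_cov : covers aF).
Context (gamv : 'cV[R]_r -> R * R) (del : R * R -> F) (delv : R * R -> 'cV[R]_r).
Local Notation gam y := (gamv (iota y)).
Hypotheses (delE : forall g, is_zunit lam g -> iota (del g) = delv g)
  (gamG : forall y : F, is_zunit lam (gam y))
  (gamK : forall y : F, del (gam y) = y)
  (delK : forall g, is_zunit lam g -> gam (del g) = g)
  (gamv1 : forall k, Cn k setT (fun v => (gamv v).1))
  (gamv2 : forall k, Cn k setT (fun v => (gamv v).2))
  (delv_smooth : forall k p (V : set 'cV[R]_p) (a b : 'cV[R]_p -> R), open V ->
    Cn k V a -> Cn k V b -> Cn k V (fun t => delv (a t, b t))).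

(** A slice-free form of a local section: T(x)^-1 x runs through a section of the
    orbits.  Equivariance is only asked on the hypersurface, where T has norm 1. *)
Definition equivariant_map (W : set 'cV[R]_N) (T : 'cV[R]_N -> R * R) : Prop :=
  [/\ open W,
      forall k, Cn k W (fun x => (T x).1) /\ Cn k W (fun x => (T x).2),
      forall x, q x = 1 -> W x -> is_zunit lam (T x),
      forall g x, is_zunit lam g -> W x -> W (act g x) &
      forall g x, is_zunit lam g -> q x = 1 -> W x -> T (act g x) = zmul lam g (T x)].

(** The inverse sends ([x], g) to g T(x)^-1 x, and T(x)^-1 = conj (T x) since T
    takes values in units.  The fibre F is identified with the group of units by
    del and gam. *)
Definition equivariant_triv (W : set 'cV[R]_N) (T : 'cV[R]_N -> R * R) : triv S M F :=
  @Triv S M F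
    [set b | W (set_val (repr b))]
    (fun s : S => del (T (set_val s)))
    (fun p => mk (act (zmul lam (gam p.2) (zconj (T (set_val (repr p.1)))))
                      (set_val (repr p.1)))).

Context (W : set 'cV[R]_N) (T : 'cV[R]_N -> R * R).
Hypothesis WT : equivariant_map W T.
Let t := equivariant_triv W T.

Lemma triv_base_pi (x : S) : triv_base t (pi x) <-> W (set_val x).
Proof.
have [_ _ _ WG _] := WT; have [g Gg E] := repr_orbit_proj AA x; rewrite /= E; split; last exact: WG.
move=> /(WG _ _ (zunit_conj Gg)); rewrite (zactM AA) zmul_conj.
by have [-> _] := Gg; rewrite zact1.
Qed.

Definition inv_act (h : R * R) x := act (zmul lam h (zconj (T x))) x.

Lemma qform_inv_act h x : is_zunit lam h -> q x = 1 -> W x -> q (inv_act h x) = 1.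
Proof.
have [_ _ TG _ _] := WT.
move=> [nh _] qx Wx; rewrite (qform_act A_sp AA) znormM nh znorm_conj.
by have [-> _] := TG _ qx Wx; rewrite qx !mulr1.
Qed.

(** The expression g T(x)^-1 x does not depend on the point x of the orbit. *)
Lemma triv_inv_pi (x : S) y : W (set_val x) ->
  set_val (triv_inv t (pi x, y)) = inv_act (gam y) (set_val x).
Proof.
have [_ _ TG _ TE] := WT; move=> Wx; have [g Gg E] := repr_orbit_proj AA x.
have qx := qform_Sigma x.
rewrite /= E.
have -> : act (zmul lam (gam y) (zconj (T (act g (set_val x))))) (act g (set_val x)) =
    inv_act (gam y) (set_val x).
  rewrite TE// (zactM AA) /inv_act; congr act.
  rewrite (_ : zmul _ _ _ = zmul lam (zmul lam (gam y) (zconj (T (set_val x)))) (zmul lam (zconj g) g)).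
    by rewrite zmul_conj; have [-> _] := Gg; rewrite zmulC zmul1.
  by rewrite /zmul /zconj /=; congr (_, _); ring.
by rewrite Sigma_ptK// qform_inv_act.
Qed.

Lemma triv_fib_inv_act h x : is_zunit lam h -> q x = 1 -> W x -> T (inv_act h x) = h.
Proof.
have [_ _ TG _ TE] := WT; move=> Gh qx Wx; have [nT p] := TG _ qx Wx.
rewrite /inv_act TE//; last by apply: zunitM => //; apply: zunit_conj.
by rewrite -zmulA zmul_conj nT zmulC zmul1.
Qed.

Lemma open_triv_base : open (triv_base t).
Proof.
have [oW _ _ _ _] := WT; rewrite /open /= /quotient_open.
rewrite (_ : _ @^-1` _ = (@set_val _ (Sigma A)) @^-1` W).
  by exists W.
apply/seteqP; split=> x.
  exact: (triv_base_pi x).1.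
exact: (triv_base_pi x).2.
Qed.

Lemma triv_fib_smooth : smooth_map_on aS aF (pi @^-1` triv_base t) (triv_fib t).
Proof.
have [oW TS TG _ _] := WT; have [ch _ _ si _] := Sigma_embedded A d.
apply: (smooth_map_into_embedded aF_emb ch (covers_Sigma Nd)).
  by apply: open_comp open_triv_base => x _; exact: orbit_proj_continuous.
move=> c ac; apply/smooth_onP => k.
have cc : is_chart c by exact: ch.
have [oD oI Kc cm ci] := cc.
have oV : open (chart_map c @` (pi @^-1` triv_base t `&` chart_dom c)).
  apply: open_chart_image => //; apply: openI => //.
  by apply: open_comp open_triv_base => x _; exact: orbit_proj_continuous.
have VW z : (chart_map c @` (pi @^-1` triv_base t `&` chart_dom c)) z ->
    W (set_val (chart_inv c z)).
  by move=> [x [Wx Dx] <-]; rewrite Kc//; exact: (triv_base_pi x).1.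
have sc : Cn k (chart_map c @` (pi @^-1` triv_base t `&` chart_dom c))
    (fun z => set_val (chart_inv c z)).
  have /smooth_onP sik := si c ac.
  by apply: Cn_sub (sik k) => _ [x [_ Dx] <-]; exact: chart_imgP.
have [T1 T2] := TS k.
have := delv_smooth oV (Cn_comp_scalar oV VW sc T1) (Cn_comp_scalar oV VW sc T2).
apply: Cn_eq oV _ => z /VW Wz.
by rewrite /= delE; [case: (T _)|apply: TG => //; exact: qform_Sigma].
Qed.

(** In a chart of the quotient the representative may be replaced by the smooth
    lift [unslice], which turns the inverse into an explicit ambient formula. *)
Lemma triv_inv_smooth :
  smooth_map_on (prod_atlas aM aF) aS (triv_base t `*` setT) (triv_inv t).
Proof.
have [oW TS TG _ _] := WT; have [chF _ _ siF _] := aF_emb.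
have chM : charts_of aM by exact: charts_orbit_atlas.
have oB : open (triv_base t `*` [set: F]).
  apply: openI; last by apply: (@open_comp (M * F)%type F snd); [move=> p _; exact: cvg_snd|exact: openT].
  by apply: (@open_comp (M * F)%type M fst); [move=> p _; exact: cvg_fst|exact: open_triv_base].
apply: (smooth_map_into_embedded (Sigma_embedded A d) (charts_of_prod chM chF)) => //.
  by apply: covers_prod => //; exact: covers_orbit_atlas.
move=> _ [_ [c2 [[u [K [L [qu uKL ->]]]] ac2 ->]]]; set c1 := slice_chart lam s0 u K L.
apply/smooth_onP => k.
set V := (X in Cn k X); have cc1 : is_chart c1 by exact: is_chart_slice.
have cc2 : is_chart c2 by exact: chF.
have cc := is_chart_prod cc1 cc2; have [oD oI Kc cm ci] := cc.
have oV : open V.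
  by apply: open_chart_image => //; apply: openI.
have [_ _ K1 _ _] := cc1; have [_ _ K2 _ _] := cc2.
pose f (z : 'cV[R]_(d + e)) := unslice A u K (usubmx z).
pose h (z : 'cV[R]_(d + e)) := iota (chart_inv c2 (dsubmx z)).
have VI z : V z -> [/\ 0 < q (u + K *m usubmx z), W (f z) & chart_img c2 (dsubmx z)].
  move=> [[b y] [[/= Bb _] [/= Db Dy]] <-]; rewrite /f /= col_mxKu col_mxKd.
  have qb : 0 < q (u + K *m chart_map c1 b).
    by have := @chart_imgP R M d c1 b Db; rewrite (slice_chart_img A_sp AA s0 qu uKL).
  split=> //; last exact: chart_imgP.
  rewrite -(Sigma_ptK s0 (qform_unslice qb)); apply: (triv_base_pi _).1.
  by change (triv_base t (chart_inv c1 (chart_map c1 b))); rewrite K1.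
have sf : Cn k V f.
  apply: (@Cn_comp R _ _ V _ _ oV (@open_lift_pos R m A d u K) _ k N (unslice A u K)).
  - by move=> z /VI[].
  - exact: Cn_usubmx.
  - exact: unslice_smooth.
have sh : Cn k V h.
  have /smooth_onP s2 := siF c2 ac2.
  have [_ oI2 _ _ _] := cc2.
  apply: (@Cn_comp R _ _ V (chart_img c2) (fun z : 'cV[R]_(d + e) => dsubmx z) oV oI2 _ k r (fun v => iota (chart_inv c2 v))).
  - by move=> z /VI[].
  - exact: Cn_dsubmx.
  - exact: s2.
have VW z : V z -> W (f z) by move=> /VI[].
have [T1 T2] := TS k.
have sT1 := Cn_comp_scalar oV VW sf T1; have sT2 := Cn_comp_scalar oV VW sf T2.
have Vt z : V z -> setT (h z) by [].
have sg1 := Cn_comp_scalar oV Vt sh (gamv1 k).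
have sg2 := Cn_comp_scalar oV Vt sh (gamv2 k).
have sa := CnD oV (CnM oV sg1 sT1) (CnM oV (Cn_cst k V (- lam)) (CnM oV sg2 sT2)).
have sb := CnD oV (CnM oV (Cn_cst k V (- 1 : R)) (CnM oV sg1 sT2)) (CnM oV sg2 sT1).
have := zact_smooth A oV sa sb sf.
apply: Cn_eq => // z /VI[Iz Wz _].
change (chart_inv (prod_chart c1 c2) z) with (pi (mk (f z)), chart_inv c2 (dsubmx z)).
rewrite triv_inv_pi ?Sigma_ptK ?qform_unslice// /inv_act; congr act.
by rewrite /zmul /zconj /cst /=; congr (_, _); ring.
Qed.

Lemma equivariant_trivP : is_triv aS aM aF pi t.
Proof.
have [oW TS TG _ _] := WT.
split.
- exact: open_triv_base.
- exact: triv_fib_smooth.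
- exact: triv_inv_smooth.
- move=> b y; have [x <-] := orbit_proj_surj b => /(triv_base_pi x).1 Wx.
  have E := triv_inv_pi y Wx; split.
    apply/esym/(orbit_proj_eqP AA); eexists; last exact: E.
    apply: zunitM => //; apply: zunit_conj; apply: TG => //; exact: qform_Sigma.
  by rewrite [LHS]/= E triv_fib_inv_act//; exact: qform_Sigma.
- move=> x /(triv_base_pi x).1 Wx; apply: val_inj.
  have GT : is_zunit lam (T (set_val x)) by apply: TG => //; exact: qform_Sigma.
  rewrite -set_valE triv_inv_pi//= delK// /inv_act zmulC zmul_conj.
  by have [-> _] := GT; rewrite zact1.
Qed.

End Trivialisation.

(** * Normalisation and square roots in the unit group *)

Section Normalise.
Context {R : realType} (lam : R).
Implicit Types (z w g : R * R).

Lemma znormalizeM g z : is_zunit lam g -> znormalize lam (zmul lam g z) = zmul lam g (znormalize lam z).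
Proof.
move=> [ng _]; rewrite /znormalize znormM ng mul1r /zmul /=.
by congr (_, _); ring.
Qed.

Lemma znormalize_smooth k p (V : set 'cV[R]_p) (f : 'cV[R]_p -> R * R) : open V ->
  (forall x, V x -> is_zpos lam (f x)) ->
  Cn k V (fun x => (f x).1) -> Cn k V (fun x => (f x).2) ->
  Cn k V (fun x => (znormalize lam (f x)).1) /\ Cn k V (fun x => (znormalize lam (f x)).2).
Proof.
move=> oV fD f1 f2.
have sn : Cn k V (fun x => znorm lam (f x)).
  have := CnD oV (CnM oV f1 f1) (CnM oV (Cn_cst k V (- lam)) (CnM oV f2 f2)).
  by apply: Cn_eq => // x _; rewrite /znorm /cst; ring.
have np x : V x -> 0 < znorm lam (f x) by move=> /fD[].
have si := Cn_inv_sqrt oV np sn.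
by split; exact: CnM.
Qed.

Hypothesis lam_ge0 : 0 <= lam.

(** In a quadratic algebra, (1 + g)^2 = g (2 + g + conj g) for a unit g, so the
    square root of g is 1 + g up to a positive real factor.  This needs 1 + g
    to lie in the cone, hence lambda >= 0. *)
Definition zroot g := znormalize lam (1 + g.1, g.2).

Lemma znorm_1D g : is_zunit lam g -> znorm lam (1 + g.1, g.2) = 2 * (1 + g.1).
Proof. by move=> [+ _]; rewrite /znorm /= => ng; lra. Qed.

Lemma zpos_1D g : is_zunit lam g -> is_zpos lam (1 + g.1, g.2).
Proof.
move=> Gg; have [_ /(_ lam_ge0) p] := Gg; split=> [|_] /=; last by lra.
by rewrite znorm_1D//; lra.
Qed.

Lemma zunit_root g : is_zunit lam g -> is_zunit lam (zroot g).
Proof. by move=> Gg; exact/zunit_normalize/zpos_1D. Qed.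

Lemma zroot_sqr g : is_zunit lam g -> zmul lam (zroot g) (zroot g) = g.
Proof.
move=> Gg; have [n0 _] := zpos_1D Gg; rewrite /zroot /znormalize /zmul /=.
move: n0; set s := (Num.sqrt _)^-1 => n0.
have ss : s * s * (2 * (1 + g.1)) = 1.
  rewrite -(znorm_1D Gg) -expr2 exprVn sqr_sqrtr ?(ltW n0)// mulVf// gt_eqF//.
have [ng _] := Gg; case: g {Gg n0} ng s ss => a b; rewrite /znorm /= => ng s ss.
have lb : lam * b ^+ 2 = a ^+ 2 - 1 by lra.
congr (_, _).
  transitivity (s * s * ((1 + a) ^+ 2 + lam * b ^+ 2)); first by ring.
  rewrite lb; transitivity (a * (s * s * (2 * (1 + a)))); first by ring.
  by rewrite ss mulr1.
transitivity (b * (s * s * (2 * (1 + a)))); first by ring.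
by rewrite ss mulr1.
Qed.

(** Squaring is injective because the group of units is then a line and has no
    element of order 2: w^2 = 1 forces w = 1, the sign condition excluding -1. *)
Lemma zsqr_inj g h : is_zunit lam g -> is_zunit lam h -> zmul lam g g = zmul lam h h -> g = h.
Proof.
move=> Gg Gh E; pose w := zmul lam g (zconj h).
have Gw : is_zunit lam w by apply: zunitM => //; exact: zunit_conj.
have [nh _] := Gh.
have w2 : zmul lam w w = (1, 0).
  rewrite (_ : zmul lam w w = zmul lam (zmul lam g g) (zmul lam (zconj h) (zconj h))).
    rewrite E (_ : zmul _ _ _ = zmul lam (zmul lam (zconj h) h) (zmul lam (zconj h) h)).
      by rewrite zmul_conj nh zmul1.
    by rewrite /zmul /zconj /=; congr (_, _); ring.
  by rewrite /w /zmul /zconj /=; congr (_, _); ring.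
have w1 : w = (1, 0).
  have [nw /(_ lam_ge0) w0] := Gw; case: w w2 nw w0 {Gw} => a b [].
  rewrite /znorm /= => E1 E2 nw a0.
  have b0 : b = 0.
    apply/eqP; have /eqP : 2 * (a * b) = 0 by rewrite -E2; ring.
    by rewrite !mulf_eq0 pnatr_eq0 (gt_eqF a0).
  have /eqP : a ^+ 2 = 1 by rewrite -nw b0; ring.
  rewrite sqrf_eq1 => /orP[/eqP -> //|/eqP a1]; first by rewrite b0.
  by move: a0; rewrite a1 ltr0N1.
have : zmul lam w h = g.
  by rewrite /w -zmulA zmul_conj nh zmulC zmul1.
by rewrite w1 zmul1.
Qed.

Lemma zrootM g z : is_zunit lam g -> is_zunit lam z ->
  zroot (zmul lam (zmul lam g g) z) = zmul lam g (zroot z).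
Proof.
move=> Gg Gz; apply: zsqr_inj.
- by apply/zunit_root/zunitM => //; exact: zunitM.
- by apply: zunitM => //; exact: zunit_root.
rewrite zroot_sqr; last by apply: zunitM => //; exact: zunitM.
by rewrite -[z in LHS]zroot_sqr// /zmul /=; congr (_, _); ring.
Qed.

End Normalise.

(** * The line bundle *)

Section Dot.
Context {R : realType} {N : nat}.
Implicit Types x y : 'cV[R]_N.

Definition dot x y : R := (x^T *m y) 0 0.

Lemma dotE x y : dot x y = \sum_i x i 0 * y i 0.
Proof. by rewrite /dot mxE; apply: eq_bigr => i _; rewrite mxE. Qed.

Lemma dotC x y : dot x y = dot y x.
Proof. by rewrite !dotE; apply: eq_bigr => i _; rewrite mulrC. Qed.

Lemma dotDr x y1 y2 : dot x (y1 + y2) = dot x y1 + dot x y2.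
Proof. by rewrite /dot mulmxDr mxE. Qed.

Lemma dotZr a x y : dot x (a *: y) = a * dot x y.
Proof. by rewrite /dot -scalemxAr mxE. Qed.

Lemma dotDl x1 x2 y : dot (x1 + x2) y = dot x1 y + dot x2 y.
Proof. by rewrite !(dotC _ y) dotDr. Qed.

Lemma dotZl a x y : dot (a *: x) y = a * dot x y.
Proof. by rewrite !(dotC _ y) dotZr. Qed.

Lemma dot_gt0 x : x != 0 -> 0 < dot x x.
Proof.
move=> x0; have d0 : 0 <= dot x x by rewrite dotE sumr_ge0// => i _; rewrite -expr2 sqr_ge0.
rewrite lt_neqAle d0 andbT eq_sym; apply: contra x0 => /eqP.
rewrite dotE => /psumr_eq0P H; apply/eqP/colP => i; apply/eqP.
by rewrite mxE -sqrf_eq0 expr2 H// => j _; rewrite -expr2 sqr_ge0.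
Qed.

Lemma Cn_dot k p (U : set 'cV[R]_p) (f g : 'cV[R]_p -> 'cV[R]_N) : open U ->
  Cn k U f -> Cn k U g -> Cn k U (fun t => dot (f t) (g t)).
Proof.
move=> oU cf cg; apply: (@Cn_eq R p _ k U (fun t => \sum_i f t i 0 * g t i 0)) => //.
  by move=> t _; rewrite dotE.
by apply: Cn_sum => // i; apply: CnM => //; exact: Cn_coord.
Qed.

End Dot.

Section Line.
Context {R : realType} {m : nat} (A : 'M[R]_(m + m)) (lam : R).
Hypotheses (A_sp : sp A) (AA : A *m A = lam%:M) (lam_ge0 : 0 <= lam).
Local Notation N := (m + m)%N.
Local Notation act := (zact A).
Local Notation q := (qform A).
Implicit Types (x u : 'cV[R]_N) (w g : R * R).

(** In terms of the Euclidean inner product, which the group does not preserve;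
    the combination is chosen so that it is multiplied by g^2. *)
Definition zgram x : R * R := ((lam * dot x x + dot (A *m x) (A *m x)) / 2, dot x (A *m x)).

Lemma zgram_act g x : zgram (act g x) = zmul lam (zmul lam g g) (zgram x).
Proof.
rewrite /zgram mulmx_zact /act !dotDl !dotDr !dotZl !dotZr (mulmxAA AA) !dotZl !dotZr.
by rewrite (dotC (A *m x) x) /zmul /=; congr (_, _); field.
Qed.

(** With k^2 = lambda, four times the norm is |A x + k x|^2 |A x - k x|^2, and
    A x is no multiple of x because Omega(x, A x) = 1 while Omega(x, x) = 0. *)
Lemma zgram_zpos x : q x = 1 -> is_zpos lam (zgram x).
Proof.
move=> qx; pose k := Num.sqrt lam; have k2 : lam = k * k by rewrite -expr2 sqr_sqrtr.
have ev c : A *m x != c *: x.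
  apply/eqP => E; have := qx; rewrite /qform E OmegaZr Omegaxx mulr0 => /eqP.
  by rewrite eq_sym oner_eq0.
have p c : 0 < dot (A *m x - c *: x) (A *m x - c *: x).
  by apply: dot_gt0; rewrite subr_eq0 ev.
have := p k; have := p (- k).
rewrite scaleNr opprK -scaleNr !dotDl !dotDr !dotZl !dotZr (dotC (A *m x) x).
rewrite /is_zpos /zgram /znorm /= => p1 p2.
set X := dot x x in p1 p2 *; set Y := dot (A *m x) (A *m x) in p1 p2 *.
set Z := dot x (A *m x) in p1 p2 *.
have e1 : 0 < Y + lam * X + 2 * (k * Z) by rewrite k2; move: p1; congr (0 < _); ring.
have e2 : 0 < Y + lam * X - 2 * (k * Z) by rewrite k2; move: p2; congr (0 < _); ring.
split=> [|_]; last by lra.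
rewrite (_ : _ - _ = (Y + lam * X + 2 * (k * Z)) * (Y + lam * X - 2 * (k * Z)) / 4).
  by rewrite divr_gt0// mulr_gt0.
by rewrite {2}k2; field.
Qed.

Definition line_coord x := zroot lam (znormalize lam (zgram x)).
Definition line_dom : set 'cV[R]_N := [set x | is_zpos lam (zgram x)].

Lemma zgram_smooth k (V : set 'cV[R]_N) : open V ->
  Cn k V (fun x => (zgram x).1) /\ Cn k V (fun x => (zgram x).2).
Proof.
move=> oV; have sA := Cn_mulmx A oV (@Cn_id R k N V); have si := @Cn_id R k N V.
split; last exact: Cn_dot.
apply: CnM => //; last exact: Cn_cst.
by apply: CnD => //; [apply: CnM => //; [exact: Cn_cst|]|]; exact: Cn_dot.
Qed.

Lemma open_line_dom : open line_dom.
Proof.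
have [s1 s2] := zgram_smooth 0 (@openT 'cV[R]_N).
by apply: open_zpos => x; [exact: (s1 x I)|exact: (s2 x I)].
Qed.

Lemma line_coord_equivariant : equivariant_map A lam line_dom line_coord.
Proof.
split.
- exact: open_line_dom.
- move=> k; have oW := open_line_dom; have [s1 s2] := zgram_smooth k oW.
  have [n1 n2] := znormalize_smooth oW (fun x => id) s1 s2.
  apply: znormalize_smooth => //= [x Wx|].
    exact: (zpos_1D lam_ge0 (zunit_normalize Wx)).
  by apply: CnD => //; exact: Cn_cst.
- by move=> x qx Wx; exact/zunit_root/zunit_normalize.
- move=> g x Gg Wx; rewrite /line_dom /= zgram_act; apply: zposM => //.
  by apply/zunit_zpos/zunitM.
- move=> g x Gg qx Wx; rewrite /line_coord zgram_act znormalizeM; last exact: zunitM.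
  by rewrite zrootM//; exact: zunit_normalize.
Qed.

(** The second component is a global coordinate on the group, the first being
    the positive solution of a^2 = 1 + lambda b^2. *)
Definition line_gam (v : 'cV[R]_1) : R * R := (Num.sqrt (1 + lam * v 0 0 ^+ 2), v 0 0).
Definition line_del (g : R * R) : 'cV[R]_1 := g.2%:M.

Lemma line_rad v : 0 < 1 + lam * v ^+ 2.
Proof. by rewrite ltr_wpDr// mulr_ge0// sqr_ge0. Qed.

(** One global trivialisation suffices, and the only transition is the identity,
    which is the scaling by 1. *)
Lemma orbit_line_bundle d (s0 : set_type (Sigma A)) : N = (1 + 1 + d)%N ->
  line_bundle (sub_atlas d.+1 (Sigma A)) (@orbit_atlas R m A lam d s0) (orbit_proj A).
Proof.
move=> Nd; split; first exact: proj_smooth.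
have cov : covers (@euclidean_atlas R 1) by move=> x; eexists.
have gG v : is_zunit lam (line_gam v).
  split=> [|_] /=; last by rewrite sqrtr_gt0 line_rad.
  by rewrite /znorm /= sqr_sqrtr ?ltW ?line_rad// addrK.
have gK v : line_del (line_gam v) = v.
  by rewrite /line_del /=; apply/colP => i; rewrite (ord1 i) mxE eqxx.
have dK g : is_zunit lam g -> line_gam (line_del g) = g.
  case: g => a b [/= ng /(_ lam_ge0) a0]; rewrite /line_gam /line_del mxE eqxx /=.
  congr (_, _); rewrite (_ : 1 + _ = a ^+ 2) ?sqrtr_sqr ?gtr0_norm//.
  by rewrite -ng /znorm /=; ring.
have s0T := @openT 'cV[R]_1.
have sv k : Cn k setT (fun v : 'cV[R]_1 => v 0 0) by apply: Cn_coord => //; exact: Cn_id.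
have srad k : Cn k setT (fun v : 'cV[R]_1 => 1 + lam * v 0 0 ^+ 2).
  have := CnD s0T (Cn_cst k setT (1 : R)) (CnM s0T (Cn_cst k setT lam) (CnM s0T (sv k) (sv k))).
  by apply: Cn_eq => // v _; rewrite expr2.
have g1 k : Cn k setT (fun v => (line_gam v).1).
  have p (v : 'cV[R]_1) : setT v -> 0 < 1 + lam * v 0 0 ^+ 2 by rewrite line_rad.
  have := CnM s0T (srad k) (Cn_inv_sqrt s0T p (srad k)).
  apply: Cn_eq => // v _ /=; set r := 1 + _; have r0 : 0 < r by exact: line_rad.
  rewrite -{1}[r]sqr_sqrtr ?(ltW r0)// expr2 mulfK// gt_eqF// sqrtr_gt0//.
have ds k p (V : set 'cV[R]_p) (a b : 'cV[R]_p -> R) : open V ->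
    Cn k V a -> Cn k V b -> Cn k V (fun t => line_del (a t, b t)).
  move=> oV ca cb; apply: Cn_vec => // i; rewrite (ord1 i).
  by apply: (Cn_eq oV _ cb) => t _; rewrite mxE eqxx.
pose t := equivariant_triv lam s0 id line_gam line_del line_dom line_coord.
have tP := equivariant_trivP A_sp AA Nd s0 (euclidean_atlas_embedded 1) cov
  (fun _ _ => erefl) gG gK dK g1 sv ds line_coord_equivariant.
exists [set t]; split.
- by move=> _ ->; exact: tP.
- move=> b; exists t => //; have [x <-] := orbit_proj_surj b.
  have lx : line_dom (set_val x) by apply: zgram_zpos; exact: qform_Sigma.
  exact: (triv_base_pi AA s0 id line_gam line_del line_coord_equivariant x).2.
- move=> _ _ b -> -> tb _; exists 1; first exact: oner_neq0.
  by move=> y; rewrite scale1r; have [_ _ _ /(_ b y tb)[]] := tP.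
Qed.

End Line.

(** * The circle bundle *)

Section Circle.
Context {R : realType} {m : nat} (A : 'M[R]_(m + m)) (kappa : R).
Local Notation lam := (- kappa ^+ 2).
Hypotheses (A_sp : sp A) (AA : A *m A = lam%:M) (kappa_gt0 : 0 < kappa).
Local Notation N := (m + m)%N.
Local Notation q := (qform A).
Local Notation pi := (orbit_proj A).
Implicit Types (x u : 'cV[R]_N) (w g : R * R).

Let lam_lt0 : lam < 0.
Proof. by rewrite oppr_lt0 exprn_gt0. Qed.

Lemma circle_coord_equivariant u :
  equivariant_map A lam (slice_dom A lam u) (fun x => znormalize lam (zform A u x)).
Proof.
split.
- exact: open_slice_dom.
- move=> k; have oU := @open_slice_dom R m A lam u; apply: znormalize_smooth => //.
    exact: zform1_smooth.
  exact: zform2_smooth.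
- by move=> x _ Ux; exact: zunit_normalize.
- by move=> g x Gg Ux; exact: slice_dom_act.
- by move=> g x Gg _ Ux; rewrite (zform_act A_sp AA) znormalizeM.
Qed.

Definition circle_vec (g : R * R) : 'cV[R]_2 := \col_i (if i == 0 then g.1 else kappa * g.2).
Definition circle_gam (v : 'cV[R]_2) : R * R := (v 0 0, v 1 0 / kappa).

Lemma ord2P (i : 'I_2) : i = 0 \/ i = 1.
Proof. by case: i => [[|[|//]] p]; [left|right]; apply: val_inj. Qed.

Definition rotation_mx (c s : R) : 'M[R]_2 :=
  \matrix_(i, j) (if i == 0 then if j == 0 then c else - s
                  else if j == 0 then s else c).

Lemma rotation_mxP c s : c ^+ 2 + s ^+ 2 = 1 ->
  (rotation_mx c s)^T *m rotation_mx c s = 1%:M /\ \det (rotation_mx c s) = 1.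
Proof.
move=> cs; split; last first.
  rewrite (expand_det_row _ 0) !big_ord_recl big_ord0 /cofactor !det_mx11 !mxE /=.
  by rewrite -[RHS]cs; ring.
apply/matrixP => i j; rewrite !mxE !big_ord_recl big_ord0 !mxE /=.
have [->|->] := ord2P i; have [->|->] := ord2P j; rewrite /= -?[RHS]cs; ring.
Qed.

(** Multiplication by a unit w rotates the circle: with e = kappa i the algebra
    becomes the complex numbers. *)
Lemma rotation_circle_vec g w :
  circle_vec (zmul lam g w) = rotation_mx w.1 (kappa * w.2) *m circle_vec g.
Proof.
apply/colP => i; rewrite !mxE !big_ord_recl big_ord0 !mxE /=.
by have [->|->] := ord2P i; rewrite /=; ring.
Qed.

Lemma circle_vec_in g : is_zunit lam g -> circle (circle_vec g).
Proof. by move=> [+ _]; rewrite /circle /= !mxE /= /znorm => <-; ring. Qed.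

Lemma circle_gamK v : circle_vec (circle_gam v) = v.
Proof.
apply/colP => i; rewrite mxE /=; case: eqVneq => [->//|i0].
rewrite mulrCA divff ?gt_eqF// mulr1; congr (v _ _).
by apply/val_inj; case: i i0 => [[|[|//]]].
Qed.

Lemma circle_gam_zunit v : circle v -> is_zunit lam (circle_gam v).
Proof.
rewrite /circle /= => vc; split; last by rewrite leNgt lam_lt0.
by rewrite /znorm /= -vc; field; rewrite gt_eqF.
Qed.

Lemma circle_vecK g : circle_gam (circle_vec g) = g.
Proof.
case: g => a b; rewrite /circle_gam !mxE /=; congr (_, _).
by rewrite mulrAC divff ?mul1r ?gt_eqF.
Qed.

Lemma covers_circle : covers (sub_atlas 1 (@circle R)).
Proof.
have oT := @openT 'cV[R]_2.
have sc k i : Cn k setT (fun z : 'cV[R]_2 => z i 0) by apply: Cn_coord => //; exact: Cn_id.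
apply: (@quadric_covers R 2 1 (fun z => z 0 0 ^+ 2 + z 1 0 ^+ 2)) => //.
- move=> k; apply: (Cn_eq oT _ (CnD oT (CnM oT (sc k 0) (sc k 0)) (CnM oT (sc k 1) (sc k 1)))).
  by move=> z _; rewrite !expr2.
- by move=> a x; rewrite !mxE; ring.
Qed.

(** On a common fibre two trivialisations differ by the unit conj (T_u x) T_u' x. *)
Lemma orbit_circle_bundle d (s0 : set_type (Sigma A)) : N = (1 + 1 + d)%N ->
  circle_bundle (sub_atlas d.+1 (Sigma A)) (@orbit_atlas R m A lam d s0) pi.
Proof.
move=> Nd; split; first exact: proj_smooth.
pose c0 : set_type (@circle R) :=
    exist (fun v => v \in @circle R) _ (mem_set (circle_vec_in (zunit1 lam))).
pose del g : set_type (@circle R) := insubd c0 (circle_vec g).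
have delE g : is_zunit lam g -> set_val (del g) = circle_vec g.
  by move=> Gg; apply: insubdK; rewrite inE; exact: circle_vec_in.
have gG (y : set_type (@circle R)) : is_zunit lam (circle_gam (set_val y)).
  by apply: circle_gam_zunit; exact: (set_valP y).
have gK (y : set_type (@circle R)) : del (circle_gam (set_val y)) = y.
  by apply: val_inj; rewrite -set_valE delE// circle_gamK.
have dK g : is_zunit lam g -> circle_gam (set_val (del g)) = g.
  by move=> Gg; rewrite delE// circle_vecK.
have oT := @openT 'cV[R]_2.
have g1 k : Cn k setT (fun v => (circle_gam v).1) by apply: Cn_coord => //; exact: Cn_id.
have g2 k : Cn k setT (fun v => (circle_gam v).2).
  by apply: CnM => //; [apply: Cn_coord => //; exact: Cn_id|exact: Cn_cst].
have ds k p (V : set 'cV[R]_p) (a b : 'cV[R]_p -> R) : open V ->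
    Cn k V a -> Cn k V b -> Cn k V (fun t => circle_vec (a t, b t)).
  move=> oV ca cb; apply: Cn_vec => // i.
  have [->|i0] := eqVneq i 0; first by apply: (Cn_eq oV _ ca) => t _; rewrite mxE.
  apply: (Cn_eq oV _ (CnM oV (Cn_cst k V kappa) cb)) => t _.
  by rewrite mxE (negbTE i0).
pose T u x := znormalize lam (zform A u x).
pose t u := equivariant_triv lam s0 (@set_val _ (@circle R)) circle_gam del (slice_dom A lam u) (T u).
have tP u := equivariant_trivP A_sp AA Nd s0 (sub_atlas_embedded 1 (@circle R)) covers_circle
  delE gG gK dK g1 g2 ds (circle_coord_equivariant u).
have base u (x : set_type (Sigma A)) := triv_base_pi AA s0 (@set_val _ (@circle R)) circle_gam del (circle_coord_equivariant u) x.
exists [set t u | u in setT]; split.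
- by move=> _ [u _ <-]; exact: tP.
- move=> b; have [x <-] := orbit_proj_surj b; exists (t (set_val x)); first by exists (set_val x).
  by apply: (base (set_val x) x).2; apply: slice_dom_center; exact: qform_Sigma.
- move=> _ _ b [u _ <-] [u' _ <-]; have [x <-] := orbit_proj_surj b.
  move=> /(base u x).1 Ux /(base u' x).1 Ux'.
  have qx := qform_Sigma x.
  have GT : is_zunit lam (T u (set_val x)) by exact: zunit_normalize.
  have GT' : is_zunit lam (T u' (set_val x)) by exact: zunit_normalize.
  pose w := zmul lam (zconj (T u (set_val x))) (T u' (set_val x)).
  have Gw : is_zunit lam w by apply: zunitM => //; exact: zunit_conj.
  have [wo wd] : (rotation_mx w.1 (kappa * w.2))^T *m rotation_mx w.1 (kappa * w.2) = 1%:M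
      /\ \det (rotation_mx w.1 (kappa * w.2)) = 1.
    by apply: rotation_mxP; have [<- _] := Gw; rewrite /znorm; ring.
  exists (rotation_mx w.1 (kappa * w.2)); split=> // y.
  have E := triv_inv_pi A_sp AA s0 del gG (circle_coord_equivariant u) y Ux.
  have [_ _ _ _ TE] := circle_coord_equivariant u'.
  have ET : T u' (set_val (triv_inv (t u) (pi x, y))) =
      zmul lam (circle_gam (set_val y)) w.
    rewrite E /inv_act /T TE//; last by apply: zunitM => //; exact: zunit_conj.
    by rewrite -zmulA.
  change (set_val (del (T u' (set_val (triv_inv (t u) (pi x, y))))) =
    rotation_mx w.1 (kappa * w.2) *m set_val y).
  rewrite ET delE; last exact: zunitM.
  by rewrite rotation_circle_vec circle_gamK.
Qed.

End Circle.

Unset Implicit Arguments.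

Theorem proposition7p2 (R : realType) (n : nat) (n_ge2 : (2 <= n)%N)
    (A : 'M[R]_(n.+1 + n.+1)) (A_sp : sp A) (A_neq0 : A != 0)
    (lambda : R) (A_sqr : A *m A = lambda%:M)
    (Sigma_neq0 : Sigma A !=set0) :
  let aSigma := sub_atlas (n + n).+1 (Sigma A) in
  is_manifold aSigma /\
  exists aM : set (chart (orbit_space A) (n + n)),
    [/\ is_manifold aM,
        submersion aSigma aM (orbit_proj A) &
        circle_bundle aSigma aM (orbit_proj A) \/
        line_bundle aSigma aM (orbit_proj A)].
Proof.
have Nd : (n.+1 + n.+1 = 1 + 1 + (n + n))%N by lia.
have [x Sx] := Sigma_neq0.
pose s0 : set_type (Sigma A) := exist (fun v => v \in Sigma A) x (mem_set Sx).
split; first by apply: is_manifold_Sigma; exact: Nd.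
exists (@orbit_atlas R n.+1 A lambda (n + n)%N s0); split.
- exact: is_manifold_orbit_space.
- exact: proj_submersion.
have [l0|l0] := lerP 0 lambda; [right|left]; first exact: orbit_line_bundle.
have k0 : 0 < Num.sqrt (- lambda) by rewrite sqrtr_gt0 oppr_gt0.
have k2 : lambda = - Num.sqrt (- lambda) ^+ 2 by rewrite sqr_sqrtr ?opprK// oppr_ge0 ltW.
move: k0 k2; set kappa := Num.sqrt _ => k0 k2.
by move: A_sqr; rewrite k2 => A_sqr'; exact: (orbit_circle_bundle A_sp A_sqr' k0).
Qed.
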